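(* Let $k\ge 2$ and $n$ be positive integers and let $K$ be a $k$-family on $[n]$. Consider the following conditions: (1) $K$ is positive threshold; (2) $K$ is threshold; (3) $d(K)$ is a vertex of the polytope $D_n(k)$; (4) $K$ satisfies $CC_t$ for all $t\ge 1$; (5) $K$ (equivalently its degree sequence $d(K)$) is uniquely realizable; (6) $K$ satisfies $DCC_t$ for all $t\ge 1$; (7) $K$ is isomorphic to a degree-maximal family; (8) the vicinal preorder $\prec_K$ is a total preorder; (9) $K$ satisfies the $RRST$ condition; (10) $K$ is isomorphic to a shifted family. Then (1) $\Rightarrow$ (2), (2) $\Leftrightarrow$ (3) $\Leftrightarrow$ (4), (4) $\Rightarrow$ (5), (5) $\Leftrightarrow$ (6), (6) $\Rightarrow$ (7), (7) $\Rightarrow$ (8), and (8) $\Leftrightarrow$ (9) $\Leftrightarrow$ (10). For $k\ge 3$ the four implications (1) $\Rightarrow$ (2), (4) $\Rightarrow$ (5), (6) $\Rightarrow$ (7), (7) $\Rightarrow$ (8) are strict (their converses fail for some $k$-families), while for $k=2$ all ten conditions are equivalent.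
   Context: A $k$-family $K$ on $[n]=\{1,\dots,n\}$ is a collection of distinct $k$-element subsets of $[n]$. Its degree sequence is $d(K)=(d_1(K),\dots,d_n(K))$ with $d_i(K)=|\{S\in K: i\in S\}|$. Two $k$-families $K,K'$ are isomorphic if $\sigma(K)=K'$ for some permutation $\sigma$ of $[n]$. For $S\subseteq[n]$, $\chi_S=\sum_{i\in S}e_i\in\{0,1\}^n$. $K$ is threshold if there is a linear functional $w$ on $\mathbb{R}^n$ with $S\in K$ iff $w(\chi_S)>0$ (for $S$ a $k$-subset of $[n]$). $K$ is positive threshold if there are reals $c_1,\dots,c_n>0$ and $t>0$ with $S\in K$ iff $\sum_{i\in S}c_i>t$. $D_n(k)$ is the convex hull in $\mathbb{R}^n$ of the degree sequences of all $k$-families on $[n]$. $K$ satisfies $CC_t$ if for any two $t$-tuples $(A_1,\dots,A_t)$, $(B_1,\dots,B_t)$ of $k$-subsets of $[n]$ (repetitions allowed) with $\sum_i\chi_{A_i}=\sum_i\chi_{B_i}$, whenever every $A_j\in K$, at least one $B_j\in K$. $K$ satisfies $DCC_t$ if the same holds for any two collections $\{A_1,\dots,A_t\}$, $\{B_1,\dots,B_t\}$ each consisting of $t$ distinct $k$-subsets. $K$ is uniquely realizable if there is no $k$-family $K'\ne K$ on $[n]$ with $d(K')=d(K)$. For real sequences $a=(a_1,\dots,a_n)$, $b=(b_1,\dots,b_n)$ with equal sums, $a$ majorizes $b$ ($a\unrhd b$) if $a_1+\dots+a_i\ge b_1+\dots+b_i$ for all $i$; $a\rhd b$ means $a\unrhd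 b$ and $a\ne b$. $K$ is degree-maximal if there is no $k$-family $K'\neq K$ on $[n]$ with $d(K')\rhd d(K)$. The componentwise (Gale) order on $k$-subsets of positive integers: $\{x_1<\dots<x_k\}\le\{y_1<\dots<y_k\}$ iff $x_i\le y_i$ for all $i$. $K$ is shifted if it is an order ideal (down-closed) in this order. Vicinal preorder: for $i\in[n]$, $N_K(i)=\{A\in\binom{[n]}{k-1}: i\notin A,\ A\cup\{i\}\in K\}$ and $N_K[i]=N_K(i)\cup\{A\in\binom{[n]}{k-1}: i\in A \text{ and } A\cup\{j\}\in K \text{ for some } j\notin A\}$; set $i\prec_K j$ iff $N_K[i]\supseteq N_K(j)$. It is total if for all $i,j$, $i\prec_K j$ or $j\prec_K i$. $K$ satisfies $RRST$ if there do not exist $(k-1)$-subsets $A,B$ of $[n]$ and $i,j\in[n]$ with $i,j\notin A$, $i,j\notin B$, $A\cup\{j\}\in K$, $B\cup\{i\}\in K$, but $A\cup\{i\}\notin K$ and $B\cup\{j\}\notin K$.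
   Formalization: As defined, (2) always implies (1), so (1)⇒(2) is not strict; strictness for k≥3 is instead proved for the stronger notion where c, t decide for every subset S of [n] whether S contains a member of K; this notion implies (1) and joins the equivalences at k=2. *)

(* Defs.v *)
From HB Require Import structures.
From mathcomp Require Import all_boot all_order all_fingroup all_algebra.
From mathcomp Require Import reals.

Set Implicit Arguments.
Unset Strict Implicit.
Unset Printing Implicit Defensive.

Import Order.TTheory GRing.Theory Num.Theory.

(* The ground set [n] = {1, ..., n} is represented by 'I_n = {0, ..., n-1},
   and a family of subsets of [n] by an element of {set {set 'I_n}}. *)

Definition ksubset (n k : nat) (S : {set 'I_n}) : bool := #|S| == k.

Definition kfamily (n k : nat) (K : {set {set 'I_n}}) : bool :=
  [forall S in K, ksubset k S].

Definition isomorphic (n : nat) (K K' : {set {set 'I_n}}) : Prop :=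
  exists s : {perm 'I_n}, [set s @: S | S : {set 'I_n} in K] = K'.

Section RealNotions.
Local Open Scope ring_scope.

Definition degseq (R : realType) (n : nat) (K : {set {set 'I_n}}) : 'rV[R]_n :=
  \row_(i < n) (#|[set S in K | i \in S]|)%:R.

Definition chi (R : realType) (n : nat) (S : {set 'I_n}) : 'rV[R]_n :=
  \row_(i < n) (i \in S)%:R.

Definition threshold (R : realType) (n k : nat) (K : {set {set 'I_n}}) : Prop :=
  exists w : {scalar 'rV[R]_n},
    forall S : {set 'I_n}, ksubset k S -> (S \in K <-> 0 < w (chi R S)).

Definition positive_threshold (R : realType) (n k : nat) (K : {set {set 'I_n}})
    : Prop :=
  exists (c : 'I_n -> R) (t : R),
    [/\ forall i, 0 < c i, 0 < t &
        forall S : {set 'I_n}, ksubset k S ->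
          (S \in K <-> t < \sum_(i in S) c i)].

(* The set-wise form of positive thresholdness: the weights decide, for every
   subset S of [n] and not only for the k-subsets, whether S contains a member
   of K.  For a k-subset S this says S \in K, so this implies
   positive_threshold.  The distinction matters for k >= 3: on k-subsets alone,
   if w is a functional as in threshold and N > |w(e_i)| for all i, then
   c_i := w(e_i) + N and t := k N witness positive_threshold, so the two
   notions above never differ, whereas the set-wise form is strictly stronger
   than threshold. *)
Definition setwise_positive_threshold (R : realType) (n : nat)
    (K : {set {set 'I_n}}) : Prop :=
  exists (c : 'I_n -> R) (t : R),
    [/\ forall i, 0 < c i, 0 < t &
        forall S : {set 'I_n},
          (exists2 A, A \in K & A \subset S) <-> t < \sum_(i in S) c i].

Definition convex_hull (R : realType) (n : nat) (X : 'rV[R]_n -> Prop)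
    (x : 'rV[R]_n) : Prop :=
  exists (m : nat) (a : 'I_m -> R) (p : 'I_m -> 'rV[R]_n),
    [/\ forall i, 0 <= a i, \sum_(i < m) a i = 1, forall i, X (p i) &
        x = \sum_(i < m) a i *: p i].

Definition degree_polytope (R : realType) (n k : nat) : 'rV[R]_n -> Prop :=
  convex_hull (fun x => exists2 K : {set {set 'I_n}},
                          kfamily k K & x = degseq R K).

(* A vertex of a convex set: a point of it that is not interior to a segment
   with endpoints in it, unless the segment is degenerate. *)
Definition vertex (R : realType) (n : nat) (P : 'rV[R]_n -> Prop)
    (x : 'rV[R]_n) : Prop :=
  P x /\
  forall (y z : 'rV[R]_n) (t : R), P y -> P z -> 0 < t < 1 ->
    x = t *: y + (1 - t) *: z -> y = x /\ z = x.

Definition CC (R : realType) (n k t : nat) (K : {set {set 'I_n}}) : Prop :=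
  forall A B : t.-tuple {set 'I_n},
    all (ksubset k) A -> all (ksubset k) B ->
    \sum_(S <- A) chi R S = \sum_(S <- B) chi R S ->
    (forall S, S \in A -> S \in K) -> exists2 S, S \in B & S \in K.

Definition DCC (R : realType) (n k t : nat) (K : {set {set 'I_n}}) : Prop :=
  forall A B : t.-tuple {set 'I_n},
    uniq A -> uniq B ->
    all (ksubset k) A -> all (ksubset k) B ->
    \sum_(S <- A) chi R S = \sum_(S <- B) chi R S ->
    (forall S, S \in A -> S \in K) -> exists2 S, S \in B & S \in K.

Definition uniquely_realizable (R : realType) (n k : nat) (K : {set {set 'I_n}})
    : Prop :=
  ~ exists K' : {set {set 'I_n}},
      [/\ kfamily k K', K' <> K & degseq R K' = degseq R K].

(* Partial sums are taken in the given order: the sequences are not sorted. *)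
Definition majorizes (R : realType) (n : nat) (a b : 'rV[R]_n) : Prop :=
  \sum_(j < n) a 0 j = \sum_(j < n) b 0 j /\
  forall i : 'I_n,
    \sum_(j < n | (j <= i)%N) b 0 j <= \sum_(j < n | (j <= i)%N) a 0 j.

Definition strictly_majorizes (R : realType) (n : nat) (a b : 'rV[R]_n) : Prop :=
  majorizes a b /\ a <> b.

Definition degree_maximal (R : realType) (n k : nat) (K : {set {set 'I_n}})
    : Prop :=
  ~ exists K' : {set {set 'I_n}},
      [/\ kfamily k K', K' <> K &
          strictly_majorizes (degseq R K') (degseq R K)].

End RealNotions.

Arguments degree_polytope R n k x : clear implicits.

(* enum S lists S in increasing order; all2 also requires #|S| = #|T|. *)
Definition gale_le (n : nat) (S T : {set 'I_n}) : bool :=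
  all2 (fun x y : 'I_n => x <= y) (enum S) (enum T).

Definition shifted (n : nat) (K : {set {set 'I_n}}) : Prop :=
  forall S T : {set 'I_n}, gale_le S T -> T \in K -> S \in K.

Definition open_nbhd (n k : nat) (K : {set {set 'I_n}}) (i : 'I_n)
    : {set {set 'I_n}} :=
  [set A : {set 'I_n} | [&& ksubset k.-1 A, i \notin A & i |: A \in K]].

Definition closed_nbhd (n k : nat) (K : {set {set 'I_n}}) (i : 'I_n)
    : {set {set 'I_n}} :=
  open_nbhd k K i :|:
  [set A : {set 'I_n} | [&& ksubset k.-1 A, i \in A
                          & [exists j, (j \notin A) && (j |: A \in K)]]].

Definition vicinal (n k : nat) (K : {set {set 'I_n}}) : rel 'I_n :=
  fun i j => open_nbhd k K j \subset closed_nbhd k K i.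

Definition RRST (n k : nat) (K : {set {set 'I_n}}) : Prop :=
  ~ exists (A B : {set 'I_n}) (i j : 'I_n),
      [/\ ksubset k.-1 A, ksubset k.-1 B,
          [/\ i \notin A, j \notin A, i \notin B & j \notin B],
          (j |: A \in K) && (i |: B \in K) &
          (i |: A \notin K) && (j |: B \notin K)].

(* Main.v *)
Require Import Defs.
From HB Require Import structures.
From mathcomp Require Import all_boot all_order all_fingroup all_algebra.
From mathcomp Require Import reals.
From mathcomp Require Import zify ring lra.

(* Everything is reduced to the integer degrees of K and to the relation
   "dominates K i j": exchanging j for i in a member of K gives a member of K.
   - A threshold family can be separated strictly, hence its degree sequence is
     the only maximum of a linear functional.  A violation of CC_t writes d(K)
     as a proper average, and if there is none then Gordan's alternative, with
     integer coefficients, gives the separating functional.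
   - DCC_t fails for some t exactly when a set of members can be exchanged for
     other k-sets without changing the degrees.
   - If K is uniquely realizable, with nonincreasing degrees, then a sequence
     that strictly majorizes d(K) can be brought down to d(K) by unit moves, and
     the last of them can be done in two ways.
   - A degree-maximal family is compressed (i dominates j for i < j), which is
     the same as shifted.  The vicinal preorder is "dominates", and RRST says
     that it is total; sorting the vertices by degree then gives a shifted
     family.
   - A graph with RRST is built by adding isolated and dominating vertices, and
     the weights are built along.
   The separating examples for k >= 3 are padded triple systems, except for the
   first one, which is the family of the k-sets that meet a fixed pair. *)

Set Implicit Arguments.
Unset Strict Implicit.
Unset Printing Implicit Defensive.
Import Order.TTheory GRing.Theory Num.Theory.

(** * Degrees and trades *)

Section Degrees.
Variable n : nat.
Implicit Types (K L A B : {set {set 'I_n}}) (S : {set 'I_n}) (i j : 'I_n).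

Definition deg K i : nat := #|[set S in K | i \in S]|.

Lemma degE K i : deg K i = \sum_(S in K) (i \in S).
Proof.
rewrite /deg -sum1_card (eq_bigl (fun S => (S \in K) && (i \in S))).
  by rewrite big_mkcondr /=; apply: eq_bigr => S _; case: ifP.
by move=> S; rewrite inE.
Qed.

Lemma kfamilyP k K : reflect {in K, forall S, #|S| = k} (kfamily k K).
Proof. by apply: (iffP forall_inP) => KP S /KP /eqP. Qed.

Lemma sum_count_mem (s : seq {set 'I_n}) k :
  all (ksubset k) s -> \sum_i count (fun S => i \in S) s = k * size s.
Proof.
move=> /allP sP; under eq_bigr => i _ do rewrite -sum1_count big_mkcond /=.
have -> : k * size s = \sum_(S <- s) k by rewrite big_const_seq iter_addn_0 count_predT.
rewrite exchange_big /=.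
rewrite [LHS]big_seq [RHS]big_seq; apply: eq_bigr => S /sP /eqP <-.
by rewrite -big_mkcond sum1_card.
Qed.

Lemma sum_deg k K : kfamily k K -> \sum_i deg K i = k * #|K|.
Proof.
move=> /kfamilyP KP; under eq_bigr => i _ do rewrite degE.
rewrite exchange_big /= mulnC -sum_nat_const; apply: eq_bigr => S /KP <-.
by rewrite -sum1_card [RHS]big_mkcond /=; apply: eq_bigr => i _; case: ifP.
Qed.

Lemma deg_card k K L :
  0 < k -> kfamily k K -> kfamily k L -> deg K =1 deg L -> #|K| = #|L|.
Proof.
move=> k_gt0 KP LP eqKL; apply/eqP; rewrite -(eqn_pmul2l k_gt0).
by rewrite -!sum_deg //; apply/eqP; apply: eq_bigr => i _.
Qed.

Lemma deg_setID K L i : deg K i = deg (K :&: L) i + deg (K :\: L) i.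
Proof. by rewrite !degE (big_setID L). Qed.

Lemma deg_setU K L i : [disjoint K & L] -> deg (K :|: L) i = deg K i + deg L i.
Proof.
rewrite disjoint_sym => /setDidPl dLK.
by rewrite (deg_setID _ K) setUK setDUl setDv set0U dLK.
Qed.

Lemma deg_uniq (s : seq {set 'I_n}) i :
  uniq s -> deg [set S in s] i = count (fun S => i \in S) s.
Proof.
move=> us; rewrite degE -sum1_count [RHS]big_mkcond /= big_uniq //.
by apply: eq_big => [S | S _]; rewrite ?inE //; case: ifP.
Qed.

(** Kept additive because subtraction of natural numbers truncates; later changes of degree have the
    same form. *)
Lemma deg_exchange K A B i : A \subset K -> [disjoint K & B] ->
  deg (K :\: A :|: B) i + deg A i = deg K i + deg B i.
Proof.
move=> /setIidPr sAK dKB; rewrite deg_setU; last first.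
  by apply: disjointWl dKB; apply: subsetDl.
by rewrite (deg_setID K A) sAK addnAC [deg A i + _]addnC.
Qed.

Lemma kfamily_exchange k K A B :
  kfamily k K -> {in B, forall S, #|S| = k} -> kfamily k (K :\: A :|: B).
Proof.
move=> /kfamilyP KP BP; apply/kfamilyP => S; rewrite !inE.
by case/orP=> [/andP[_ /KP] | /BP].
Qed.

Definition unique_deg k K : Prop :=
  forall L, kfamily k L -> deg L =1 deg K -> L = K.

(** All conditions CC_t with t >= 1 in one, with [size A] in the role of t and integer counts in
    place of real vectors. *)
Definition trade_robust k K : Prop := forall A B : seq {set 'I_n},
  0 < size A -> size A = size B -> all (ksubset k) A -> all (ksubset k) B ->
  (forall i, count (fun S => i \in S) A = count (fun S => i \in S) B) ->
  {subset A <= K} -> exists2 S, S \in B & S \in K.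

Definition distinct_trade_robust k K : Prop := forall A B : seq {set 'I_n},
  uniq A -> uniq B ->
  0 < size A -> size A = size B -> all (ksubset k) A -> all (ksubset k) B ->
  (forall i, count (fun S => i \in S) A = count (fun S => i \in S) B) ->
  {subset A <= K} -> exists2 S, S \in B & S \in K.

(** A violated trade turns [K] into another family with the same degrees. Conversely, a second
    realization [L] gives the trade of [K :\: L] for [L :\: K]; these have equal size because the
    degree sum is k times the number of members. *)
Lemma unique_degP k K : 0 < k -> kfamily k K ->
  unique_deg k K <-> distinct_trade_robust k K.
Proof.
move=> k_gt0 KP; split=> [UR A B uA uB sz0 szAB AP BP cAB sAK | DR L LP dL].
  have [/hasP[S SB SK] | /hasPn nBK] := boolP (has (mem K) B); first by exists S.
  have sA : [set S in A] \subset K by apply/subsetP => S; rewrite inE => /sAK.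
  have dB : [disjoint K & [set S in B]].
    by rewrite disjoint_sym disjoint_subset; apply/subsetP => S; rewrite !inE => /nBK.
  (* The head of [A] is deleted from [K], so it could return only as a member of [B], but no set of
     [B] lies in [K]. *)
  suff /setP/(_ (head set0 A)) : K :\: [set S in A] :|: [set S in B] = K.
    case: A sz0 sAK {sA UR uA cAB AP szAB} => // S A _ sAK.
    rewrite !inE eqxx /= (sAK S (mem_head _ _)) => SB.
    by have := nBK S SB; rewrite /= (sAK S (mem_head _ _)).
  apply: UR => [|i].
    by apply: kfamily_exchange => // S; rewrite inE => /(allP BP)/eqP.
  by have := deg_exchange i sA dB; rewrite !deg_uniq // cAB => /addIn.
apply/eqP/contraT => nLK.
have eqc : #|K :\: L| = #|L :\: K|.
  have := cardsID L K; have := cardsID K L; rewrite (deg_card k_gt0 LP KP dL) setIC.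
  lia.
have Kk S : S \in K -> #|S| = k by move/kfamilyP: KP; apply.
have Lk S : S \in L -> #|S| = k by move/kfamilyP: LP; apply.
have [||||||i|S|S] := DR (enum (K :\: L)) (enum (L :\: K)).
- exact: enum_uniq.
- exact: enum_uniq.
- rewrite -cardE lt0n cards_eq0; apply: contra nLK; rewrite setD_eq0 => sKL.
  by rewrite eq_sym eqEcard sKL (deg_card k_gt0 LP KP dL) /=.
- by rewrite -!cardE.
- by apply/allP => S; rewrite mem_enum !inE => /andP[_ /Kk/eqP].
- by apply/allP => S; rewrite mem_enum !inE => /andP[_ /Lk/eqP].
- rewrite -!deg_uniq ?enum_uniq // !set_enum.
  by have := dL i; rewrite (deg_setID L K) (deg_setID K L) setIC => /addnI.
- by rewrite mem_enum inE => /andP[].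
- by rewrite mem_enum inE => /andP[/negbTE->].
Qed.

End Degrees.

(** * Domination and the vicinal preorder *)

Section Domination.
Variable n : nat.
Implicit Types (K L : {set {set 'I_n}}) (S : {set 'I_n}) (i j : 'I_n).
Implicit Types s : {perm 'I_n}.

Definition replace i j S := i |: (S :\ j).

Lemma replaceK i j S : j \in S -> i \notin S -> replace j i (replace i j S) = S.
Proof.
move=> jS iS; apply/setP => x; rewrite !inE.
have [->|xj] /= := eqVneq x j; first by rewrite jS.
by have [->|] //= := eqVneq x i; rewrite (negbTE iS).
Qed.

Lemma mem_replace i j S : j \in S -> i \notin S ->
  i \in replace i j S /\ j \notin replace i j S.
Proof.
move=> jS iS; rewrite !inE !eqxx /= orbF; split=> //.
by apply: contra iS => /eqP <-.
Qed.

Lemma card_replace i j S : j \in S -> i \notin S -> #|replace i j S| = #|S|.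
Proof.
move=> jS iS; rewrite cardsU1 !inE (negbTE iS) andbF /=.
by rewrite (cardsD1 j S) jS.
Qed.

Definition dominates K i j : bool :=
  [forall S in K, (j \in S) ==> (i \notin S) ==> (replace i j S \in K)].

Lemma dominatesP K i j : reflect
  (forall S, S \in K -> j \in S -> i \notin S -> replace i j S \in K)
  (dominates K i j).
Proof.
apply: (iffP forall_inP) => H S SK; first by move=> jS iS; have := H S SK; rewrite jS iS.
by apply/implyP => jS; apply/implyP; apply: H.
Qed.

Lemma dominatesPn K i j : reflect
  (exists S, [/\ S \in K, j \in S, i \notin S & replace i j S \notin K])
  (~~ dominates K i j).
Proof.
rewrite negb_forall_in; apply: (iffP exists_inP) => [[S SK]|[S [SK jS iS nS]]].
  by rewrite !negb_imply => /and3P[]; exists S.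
by exists S; rewrite // !negb_imply jS iS.
Qed.

(** Let [A] be in the open neighbourhood of j. If i lies in [A], then j itself witnesses that [A] is
    in the closed neighbourhood of i; otherwise [i |: A] is the set [replace i j (j |: A)]. *)
Lemma vicinalE k K i j : kfamily k K -> vicinal k K i j = dominates K i j.
Proof.
move=> /kfamilyP KP; apply/subsetP/dominatesP => [sN S SK jS iS | dK A].
  have := sN (S :\ j); rewrite !inE eqxx /= setD1K // SK (negbTE iS) !andbF /= !andbT orbF.
  case/(_ _)/andP => //.
  by rewrite /ksubset -(KP S SK) (cardsD1 j S) jS.
rewrite !inE => /and3P[Ak jA AK]; rewrite Ak /=.
have [iA | iA] /= := boolP (i \in A); first by apply/existsP; exists j; rewrite jA.
have [eij|nij] := eqVneq i j; first by rewrite eij AK.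
have := dK _ AK; rewrite /replace setU1K // !inE (negbTE nij) (negbTE iA) eqxx /=.
by move=> ->.
Qed.

Lemma total_vicinalE k K : kfamily k K ->
  total (vicinal k K) <-> forall i j, dominates K i j || dominates K j i.
Proof. by move=> KP; split=> H i j; have := H i j; rewrite !(vicinalE _ _ KP). Qed.

(** A forbidden configuration is a failure of domination in both directions: [A] and [B] are the two
    witnesses with j, respectively i, removed. *)
Lemma RRSTE k K : kfamily k K ->
  RRST k K <-> forall i j, dominates K i j || dominates K j i.
Proof.
move=> /kfamilyP KP; split=> [rK i j | dK [A [B [i [j [_ _ [iA jA iB jB]]]]]]].
  apply/contraT; rewrite negb_or => /andP[].
  case/dominatesPn=> S [SK jS iS nS] /dominatesPn[T [TK iT jT nT]]; case: rK.
  exists (S :\ j), (T :\ i), i, j; rewrite !setD1K // SK TK nS nT !inE !eqxx.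
  rewrite (negbTE iS) (negbTE jT) !andbF /ksubset.
  by rewrite -{1}(KP S SK) (cardsD1 j S) jS -(KP T TK) (cardsD1 i T) iT !eqxx.
case/andP=> jAK iBK /andP[iAK jBK].
have [eij|nij] := eqVneq i j; first by rewrite eij jAK in iAK.
case/orP: (dK i j) => /dominatesP.
  move=> /(_ _ jAK); rewrite /replace setU1K // !inE eqxx (negbTE nij) (negbTE iA).
  by rewrite (negbTE iAK) => /(_ isT isT).
move=> /(_ _ iBK); rewrite /replace setU1K // !inE eqxx eq_sym (negbTE nij) (negbTE jB).
by rewrite (negbTE jBK) => /(_ isT isT).
Qed.

Definition only K i j := [set S in K | (i \in S) && (j \notin S)].

(** Members that contain both i and j cancel. *)
Lemma deg_only K i j : deg K i + #|only K j i| = deg K j + #|only K i j|.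
Proof.
have E a b : deg K a = #|[set S in K | (a \in S) && (b \in S)]| + #|only K a b|.
  rewrite /deg -(cardsID [set S : {set 'I_n} | b \in S]); congr (_ + _).
    by apply: eq_card => S; rewrite !inE andbA.
  by apply: eq_card => S; rewrite !inE; case: (S \in K); rewrite ?andbF //= andbC.
rewrite (E i j) (E j i) addnAC; congr (_ + _ + _).
by apply: eq_card => S; rewrite !inE [_ && (j \in S)]andbC.
Qed.

Lemma replace_inj i j :
  {in [pred S : {set 'I_n} | (j \in S) && (i \notin S)] &, injective (replace i j)}.
Proof.
move=> S T; rewrite !inE => /andP[jS iS] /andP[jT iT] eST.
by rewrite -[S](replaceK jS iS) eST replaceK.
Qed.

(* Members S of [only K j i] with [replace i j S] in K inject into [only K i j]. *)
Lemma leq_only K i j :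
  #|only K j i| <= #|only K i j| + #|[set S in only K j i | replace i j S \notin K]|.
Proof.
rewrite -(cardsID [set S : {set 'I_n} | replace i j S \in K]) leq_add //; last first.
  by apply/subset_leq_card/subsetP => S; rewrite !inE andbC.
rewrite -(card_in_imset (f := replace i j)); last first.
  move=> S T; rewrite !inE => /andP[/and3P[_ jS iS] _] /andP[/and3P[_ jT iT] _].
  by apply: replace_inj; rewrite inE ?jS ?jT.
apply/subset_leq_card/subsetP => T /imsetP[S]; rewrite !inE.
move=> /andP[/and3P[SK jS iS] rK] ->; have [-> ->] := mem_replace jS iS.
by rewrite rK.
Qed.

Lemma dominates_leq K i j : dominates K i j -> #|only K j i| <= #|only K i j|.
Proof.
move=> /dominatesP dK; apply: leq_trans (leq_only K i j) _.
rewrite [X in _ + X]eq_card0 ?addn0 // => S; rewrite !inE.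
by apply/negbTE/negP => /andP[/and3P[SK jS iS]]; rewrite dK.
Qed.

Lemma dominates_deg K i j : dominates K i j -> deg K j <= deg K i.
Proof. by move/dominates_leq; have := deg_only K i j; lia. Qed.

(** If only j dominates i, then [replace j i] injects [only K i j] into [only K j i], and a witness
    against [dominates K i j] is missed by the image. Hence i would have a smaller degree than j. *)
Lemma deg_dominates K i j :
  (forall i j, dominates K i j || dominates K j i) -> deg K j <= deg K i ->
  dominates K i j.
Proof.
move=> tK le_ji; apply/contraT => ndK; have := tK i j; rewrite (negbTE ndK) /=.
move=> /dominatesP dji; case/dominatesPn: ndK => S [SK jS iS nS].
suff : #|only K i j| < #|only K j i| by have := deg_only K i j; lia.
have [Si Sj] := mem_replace jS iS.
rewrite -(card_in_imset (f := replace j i)); last first.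
  move=> T U; rewrite !inE => /and3P[_ jT iT] /and3P[_ jU iU].
  by apply: replace_inj; rewrite inE ?jT ?jU.
apply: proper_card; apply/properP; split.
  apply/subsetP => U /imsetP[T]; rewrite !inE => /and3P[TK iT jT] ->.
  by have [-> ->] := mem_replace iT jT; rewrite dji.
exists S; first by rewrite inE SK jS.
apply/imsetP => -[T]; rewrite !inE => /and3P[TK iT jT] eST.
by rewrite eST replaceK ?TK in nS.
Qed.

Definition compressed K : Prop := forall i j, i < j -> dominates K i j.

Lemma dominates_refl K i : dominates K i i.
Proof. by apply/dominatesP => S _ ->. Qed.

Lemma compressed_total K : compressed K -> forall i j, dominates K i j || dominates K j i.
Proof.
move=> cK i j; case: (ltngtP i j) => [/cK->|/cK->|/val_inj->] //; rewrite ?orbT //.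
by rewrite dominates_refl.
Qed.

Lemma compressed_deg K i j : compressed K -> i <= j -> deg K j <= deg K i.
Proof.
move=> cK; rewrite leq_eqVlt => /predU1P[/val_inj-> //|/cK]; exact: dominates_deg.
Qed.

(** * Sorting the vertices by a numeric function *)

Lemma sort_perm (f : 'I_n -> nat) :
  exists p : {perm 'I_n}, forall i j, i <= j -> f (p j) <= f (p i).
Proof.
pose r := [rel x y | f y <= f x].
have rtot : total r by move=> x y; apply: leq_total.
have rtr : transitive r by move=> y x z /= ? /leq_trans; apply.
have szs : size (sort r (ord_tuple n)) == n by rewrite size_sort size_tuple.
have [p Ep] : exists p : {perm 'I_n},
    Tuple szs = [tuple tnth (ord_tuple n) (p i) | i < n] :> seq _.
  by apply/tuple_permP; rewrite perm_sort.
exists p => i j le_ij.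
(* The same [x] is the default of [nth] and, coerced to a natural number, the index. *)
have E x : p x = nth x (sort r (ord_tuple n)) x.
  have -> : sort r (ord_tuple n) = tval (Tuple szs) by [].
  by rewrite Ep -tnth_nth tnth_mktuple tnth_ord_tuple.
have := sorted_leq_nth rtr (fun x => leqnn (f x)) i (sort_sorted rtot (ord_tuple n)).
rewrite (E i) (E j) => /(_ i j); rewrite !inE !(eqP szs) !ltn_ord => /(_ isT isT le_ij).
by rewrite /= (set_nth_default i j) ?(eqP szs).
Qed.

(** The lists of values of f and g are permutations of each other and both nonincreasing, hence
    equal. *)
Lemma sorted_perm_eq (f g : 'I_n -> nat) (p : {perm 'I_n}) :
  (forall i j, i <= j -> f j <= f i) -> (forall i j, i <= j -> g j <= g i) ->
  (forall i, g i = f (p i)) -> f =1 g.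
Proof.
move=> fmon gmon fg.
have mono (h : 'I_n -> nat) : (forall i j, i <= j -> h j <= h i) ->
    sorted geq [seq h i | i <- enum 'I_n].
  move=> hmon; rewrite sorted_map.
  have : sorted (relpre val leq) (enum 'I_n).
    by rewrite -sorted_map val_enum_ord iota_sorted.
  by apply: sub_sorted => x y; apply: hmon.
have pE : perm_eq [seq f i | i <- enum 'I_n] [seq g i | i <- enum 'I_n].
  rewrite perm_sym (eq_map fg) (map_comp f p); apply: perm_map.
  apply: uniq_perm; rewrite ?(map_inj_uniq perm_inj) ?enum_uniq // => x.
  rewrite mem_enum inE; apply/mapP; exists ((p^-1)%g x); rewrite ?mem_enum //.
  by rewrite permKV.
have anti : antisymmetric geq by move=> x y; rewrite andbC; apply: anti_leq.
have tr : transitive geq by move=> y x z /= ? /leq_trans; apply.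
have /eq_in_map E := sorted_eq tr anti (mono f fmon) (mono g gmon) pE.
by move=> i; apply: E; rewrite mem_enum.
Qed.

(** * Relabelling the ground set *)

Definition relabel (s : {perm 'I_n}) K := [set s @: S | S : {set 'I_n} in K].

Lemma mem_relabel (s : {perm 'I_n}) K S : (s @: S \in relabel s K) = (S \in K).
Proof. by rewrite /relabel mem_imset //; apply/imset_inj/perm_inj. Qed.

Lemma mem_relabelV (s : {perm 'I_n}) K S : (S \in relabel s K) = ((s^-1)%g @: S \in K).
Proof.
rewrite -(mem_relabel s) -imset_comp (eq_imset (g := id)) ?imset_id //.
by move=> x /=; rewrite permKV.
Qed.

Lemma kfamily_relabel k s K : kfamily k K -> kfamily k (relabel s K).
Proof.
move=> /kfamilyP KP; apply/kfamilyP => _ /imsetP[S SK ->].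
by rewrite card_imset ?KP //; apply: perm_inj.
Qed.

Lemma relabelK s K : relabel (s^-1)%g (relabel s K) = K.
Proof. by apply/setP => S; rewrite mem_relabelV invgK mem_relabel. Qed.

Lemma deg_relabel s K i : deg (relabel s K) (s i) = deg K i.
Proof.
rewrite /deg -[RHS](card_imset _ (imset_inj (@perm_inj _ s))); apply: eq_card => T.
have -> : T = s @: (s^-1%g @: T).
  by rewrite -imset_comp (eq_imset (g := id)) ?imset_id // => x /=; rewrite permKV.
rewrite (mem_imset _ _ (imset_inj (@perm_inj _ s))) !inE mem_relabel.
by rewrite (mem_imset _ _ (@perm_inj _ s)).
Qed.

Lemma replace_relabel (s : {perm 'I_n}) i j S :
  replace (s i) (s j) (s @: S) = s @: replace i j S.
Proof.
apply/setP => x; rewrite -[x](permKV s) (mem_imset _ _ (@perm_inj _ s)) !inE.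
by rewrite !(inj_eq (@perm_inj _ s)) (mem_imset _ _ (@perm_inj _ s)).
Qed.

Lemma dominates_relabel s K i j :
  dominates K i j -> dominates (relabel s K) (s i) (s j).
Proof.
move=> /dominatesP dK; apply/dominatesP => _ /imsetP[S SK ->].
rewrite replace_relabel mem_relabel !(mem_imset _ _ (@perm_inj _ s)).
exact: dK.
Qed.

Lemma total_relabel s K :
  (forall i j, dominates (relabel s K) i j || dominates (relabel s K) j i) ->
  forall i j, dominates K i j || dominates K j i.
Proof.
move=> tK i j; rewrite -(relabelK s K) -[i](permK s) -[j](permK s).
by case/orP: (tK (s i) (s j)) => /(dominates_relabel s^-1%g)->; rewrite ?orbT.
Qed.

End Domination.

(** * Shifted families *)

Section Shifted.
Variable n : nat.
Implicit Types (K : {set {set 'I_n}}) (S T : {set 'I_n}) (i j : 'I_n).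
Implicit Types s t p : seq 'I_n.

Local Notation increasing := (pairwise (fun x y : 'I_n => x < y)).

Lemma increasing_enum S : increasing (enum S).
Proof.
rewrite {1}/enum_mem; apply: pairwise_filter.
rewrite -enumT -(pairwise_map val ltn) val_enum_ord.
by rewrite -sorted_pairwise ?iota_ltn_sorted //; apply: ltn_trans.
Qed.

Lemma enum_increasing s : increasing s -> enum [set x in s] = s.
Proof.
move=> incs; have tr : transitive (fun x y : 'I_n => x < y).
  by move=> y x z; apply: ltn_trans.
apply: (irr_sorted_eq tr (fun x => ltnn x)).
- by rewrite sorted_pairwise ?increasing_enum.
- by rewrite sorted_pairwise.
- by move=> x; rewrite mem_enum inE.
Qed.

(** Induction along a growing common prefix [p]. When the next entries satisfy x < y, exchanging y
    for x in the larger set stays in [K] by compression and makes x part of the prefix; x is new,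
    since it lies above [p] and below y. *)
Lemma compressed_all2 K p s t : compressed K ->
  increasing (p ++ s) -> increasing (p ++ t) ->
  all2 (fun x y : 'I_n => x <= y) s t ->
  [set x in p ++ t] \in K -> [set x in p ++ s] \in K.
Proof.
move=> cK; elim: s p t => [|x s IHs] p [|y t] //= incs inct /andP[le_xy le_st] KT.
have cat_r q z : p ++ z :: q = rcons p z ++ q by rewrite cat_rcons.
case: (ltngtP x y) le_xy => // [lt_xy _ | /val_inj exy _]; last first.
  rewrite -exy in inct KT; rewrite cat_r in KT; rewrite cat_r.
  by apply: (IHs _ t) => //; rewrite -cat_r.
have [px pt yt] : [/\ all (fun z : 'I_n => z < x) p, increasing p /\
    increasing t & all (fun z : 'I_n => y < z) t /\
    all (fun z : 'I_n => all (fun w : 'I_n => z < w) t) p].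
  move: incs inct; rewrite !pairwise_cat /= => /and3P[ps _ _] /and3P[pt incp /andP[yt inct]].
  do !split=> //.
    by apply/allP => z zp; apply: (allrelP ps _ _ zp (mem_head _ _)).
  apply/allP => z zp; apply/allP => w wt.
  by apply: (allrelP pt) => //; rewrite inE wt orbT.
have xpt : x \notin p ++ y :: t.
  rewrite mem_cat inE !negb_or; apply/and3P; split.
  - by apply/negP => /(allP px); rewrite ltnn.
  - by apply: contraTneq lt_xy => ->; rewrite ltnn.
  - by apply/negP => /(allP yt.1) /(ltn_trans lt_xy); rewrite ltnn.
have ypt : y \notin p ++ t.
  move: inct; rewrite (pairwise_cat _ p) /= => /and3P[pyt _ /andP[yt' _]].
  rewrite mem_cat negb_or; apply/andP; split.
    by apply/negP => yp; have := allrelP pyt _ _ yp (mem_head _ _); rewrite ltnn.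
  by apply/negP => /(allP yt'); rewrite ltnn.
have KT' : [set z in p ++ x :: t] \in K.
  have := dominatesP _ _ _ (cK x y lt_xy) _ KT; rewrite !inE mem_cat mem_head orbT.
  move=> /(_ isT xpt); congr (_ \in K); apply/setP => z.
  rewrite !inE !mem_cat !inE; have [->|_] //= := eqVneq z x; first by rewrite orbT.
  by have [->|_] //= := eqVneq z y; move: ypt; rewrite mem_cat => /negbTE->.
rewrite cat_r in KT'; rewrite cat_r; apply: (IHs _ t) => //; rewrite -cat_r //.
rewrite pairwise_cat /= pt.1 pt.2 /= !andbT; apply/andP; split.
  apply/allrelP => z w zp; rewrite inE => /predU1P[->|wt]; first exact: (allP px).
  by apply: (allP (allP yt.2 z zp)).
by apply/allP => z /(allP yt.1); apply: ltn_trans.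
Qed.

(** Each entry of the increasing list is compared with its successor. *)
Lemma all2_shift i j s :
  increasing (i :: rcons s j) -> all2 (fun x y : 'I_n => x <= y) (i :: s) (rcons s j).
Proof.
elim: s i => [|x s IHs] i /=; first by rewrite andbT andbT => /ltnW->.
by move=> /andP[/andP[/ltnW-> _] incs]; apply: IHs.
Qed.

Lemma gale_le_replace i j S :
  i < j -> j \in S -> i \notin S -> gale_le (replace i j S) S.
Proof.
move=> lt_ij jS iS; pose e := enum (S :\ j).
have ince : increasing e by apply: increasing_enum.
have memE x : (x \in e) = (x != j) && (x \in S) by rewrite mem_enum !inE.
clearbody e.
(* The common elements are cut at i and j. The two enumerations agree on [p] and [r], and in between
   they are [i :: q] and [rcons q j]. *)
pose p := [seq x : 'I_n <- e | x < i]; pose q := [seq x : 'I_n <- e | i < x < j].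
pose r := [seq x : 'I_n <- e | j < x].
have incP (a : pred 'I_n) : increasing [seq x <- e | a x] by rewrite pairwise_filter.
have inc1 : increasing (p ++ i :: q ++ r).
  rewrite pairwise_cat /= pairwise_cat !incP; apply/and4P; split=> //.
  - apply/allrelP => x y; rewrite mem_filter => /andP[ltxi _].
    rewrite inE => /predU1P[->//|]; rewrite mem_cat !mem_filter.
    by case/orP=> /andP[]; lia.
  - by apply/allP => x; rewrite mem_cat !mem_filter => /orP[]/andP[]; lia.
  - apply/andP; split=> //; apply/allrelP => x y; rewrite !mem_filter.
    by move=> /andP[/andP[_ ltxj] _] /andP[/(ltn_trans ltxj)].
have inc2 : increasing (p ++ rcons q j ++ r).
  rewrite cat_rcons pairwise_cat /= pairwise_cat /= !incP; apply/and3P; split=> //.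
  - apply/allrelP => x y; rewrite mem_filter => /andP[ltxi _].
    rewrite mem_cat inE !mem_filter.
    by case/or3P=> [/andP[]|/eqP->|/andP[]]; lia.
  - rewrite !andbT; apply/andP; split.
      apply/allrelP => x y; rewrite inE !mem_filter.
      by move=> /andP[/andP[_ ltxj] _] /predU1P[->|/andP[/(ltn_trans ltxj)]].
    by apply/allP => x; rewrite mem_filter => /andP[].
have eS : enum S = p ++ rcons q j ++ r.
  rewrite -(enum_increasing inc2); apply: eq_enum => x.
  rewrite [RHS]inE !mem_cat mem_rcons inE !mem_filter memE.
  have [->|nxj] /= := eqVneq x j; first by rewrite jS !orbT.
  have [xS|] := boolP (x \in S); rewrite ?andbF // !andbT.
  have : x != i by apply: contraNneq iS => <-.
  by move: nxj; rewrite -!val_eqE /=; lia.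
have eR : enum (replace i j S) = p ++ i :: q ++ r.
  rewrite -(enum_increasing inc1); apply: eq_enum => x.
  rewrite !inE !mem_cat inE mem_cat !mem_filter memE.
  have [->|nxi] /= := eqVneq x i; first by rewrite !orbT.
  have [->|nxj] /= := eqVneq x j; first by rewrite !andbF.
  have [xS|] := boolP (x \in S); rewrite ?andbF // !andbT.
  by move: nxj nxi; rewrite -!val_eqE /=; lia.
have all2_refl u : all2 (fun x y : 'I_n => x <= y) u u by elim: u => //= x u ->; rewrite leqnn.
have all2_cat s1 s2 t1 t2 : all2 (fun x y : 'I_n => x <= y) s1 t1 ->
    all2 (fun x y : 'I_n => x <= y) s2 t2 ->
    all2 (fun x y : 'I_n => x <= y) (s1 ++ s2) (t1 ++ t2).
  by elim: s1 t1 => [|x s1 IHs] [|y t1] //= /andP[-> /IHs H] /H.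
rewrite /gale_le eS eR -cat_cons.
apply: (all2_cat); first exact: all2_refl.
apply: all2_cat; last exact: all2_refl.
apply: all2_shift; move: inc2; rewrite !pairwise_cat => /and3P[_ _ /and3P[_ incqj _]].
move: inc1; rewrite pairwise_cat /= pairwise_cat all_cat.
move=> /and3P[_ _ /andP[/andP[iq _] _]].
by rewrite /= incqj all_rcons lt_ij iq.
Qed.

Lemma shiftedE K : shifted K <-> compressed K.
Proof.
split=> [sK i j lt_ij | cK S T leST TK].
  by apply/dominatesP => S SK jS iS; apply: sK SK; apply: gale_le_replace.
have E (U : {set 'I_n}) : U = [set x in [::] ++ enum U] by apply/setP => x; rewrite inE mem_enum.
rewrite (E T) in TK; rewrite (E S).
by apply: (compressed_all2 cK _ _ _ TK) => //; apply: increasing_enum.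
Qed.

Lemma total_isomorphic_compressed K :
  (forall i j, dominates K i j || dominates K j i) ->
  exists2 s : {perm 'I_n}, compressed (relabel s K) &
    forall i j, i <= j -> deg (relabel s K) j <= deg (relabel s K) i.
Proof.
move=> tK; have [p pP] := sort_perm (deg K).
have degP i : deg (relabel p^-1 K) i = deg K (p i).
  by rewrite -(deg_relabel p^-1 K) permK.
exists (p^-1)%g => i j lt_ij; last by rewrite !degP pP.
rewrite -[i](permK p) -[j](permK p); apply: dominates_relabel.
by apply: deg_dominates => //; apply/pP/ltnW.
Qed.

Lemma dominates_total_shifted K :
  (forall i j, dominates K i j || dominates K j i) <->
  exists2 K', isomorphic K K' & shifted K'.
Proof.
split=> [/total_isomorphic_compressed[s cK _] | [_ [s <-] /shiftedE cK]].
  by exists (relabel s K); [exists s | apply/shiftedE].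
exact/(total_relabel (s := s))/compressed_total.
Qed.

End Shifted.

(** * Majorization *)

Section Majorization.
Variable n : nat.
Implicit Types (K L : {set {set 'I_n}}) (S : {set 'I_n}) (i j p q x : 'I_n).
Implicit Types f g : 'I_n -> nat.

Definition prefix_sum f i := \sum_(j < n | j <= i) f j.

(** The hypothesis says that f arises from g by moving one unit from q to p, so a partial sum
    changes only if its range separates p from q. *)
Lemma sum_transfer (P : pred 'I_n) f g p q :
  (forall x, f x + (x == q) = g x + (x == p)) ->
  \sum_(j < n | P j) f j + P q = \sum_(j < n | P j) g j + P p.
Proof.
have E i : P i = \sum_(j < n | P j) (j == i) :> nat.
  rewrite big_mkcond (bigD1 i) //= big1 ?eqxx ?addn0; first by case: (P i).
  by move=> j /negbTE->; case: ifP.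
by move=> fg; rewrite !E -!big_split; apply: eq_bigr => j _; apply: fg.
Qed.

Definition deg_majorizes L K : Prop :=
  \sum_j deg L j = \sum_j deg K j /\
  forall i, prefix_sum (deg K) i <= prefix_sum (deg L) i.

Definition max_deg k K : Prop := forall L, kfamily k L ->
  deg_majorizes L K -> deg L =1 deg K.

Definition move_set (S T : {set 'I_n}) K := K :\: [set S] :|: [set T].

Lemma deg_move_set i j S K x :
  S \in K -> j \in S -> i \notin S -> replace i j S \notin K ->
  deg (move_set S (replace i j S) K) x + (x == j) = deg K x + (x == i).
Proof.
move=> SK jS iS nR.
have deg1 T : deg [set T] x = (x \in T) by rewrite degE big_set1.
have := @deg_exchange _ K [set S] [set replace i j S] x.
rewrite sub1set disjoint_sym disjoints1 !deg1 => /(_ SK nR).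
rewrite /move_set !inE; have [->|nxj] /= := eqVneq x j.
  by rewrite jS orbF.
by have [->|nxi] /= := eqVneq x i; [rewrite (negbTE iS) !addn0 | rewrite !addn0 => /addIn].
Qed.

Lemma kfamily_move_set k i j S K :
  kfamily k K -> S \in K -> j \in S -> i \notin S ->
  kfamily k (move_set S (replace i j S) K).
Proof.
move=> KP SK jS iS; apply: kfamily_exchange => // T; rewrite inE => /eqP->.
by rewrite card_replace //; move/kfamilyP: KP; apply.
Qed.

(** Moving a unit from q to an earlier p raises by one exactly the prefix sums at indices i with p
    <= i < q. *)
Lemma transfer_majorizes K L p q : p < q ->
  (forall x, deg L x + (x == q) = deg K x + (x == p)) ->
  deg_majorizes L K /\ deg L p <> deg K p.
Proof.
move=> lt_pq tr; split; last by have := tr p; rewrite eqxx -val_eqE /= ltn_eqF //; lia.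
split=> [|i]; first by have := sum_transfer predT tr; rewrite /= => /addIn.
have := sum_transfer (fun j => j <= i) tr; rewrite /prefix_sum.
by case: (leqP q i) => [le_qi|]; last lia; rewrite (leq_trans (ltnW lt_pq) le_qi); lia.
Qed.

(** An exchange of j for a smaller i that leaves [K] could be carried out, and would move a unit of
    degree from j to i. *)
Lemma max_deg_compressed k K : kfamily k K -> max_deg k K -> compressed K.
Proof.
move=> KP maxK i j lt_ij; apply/dominatesP => S SK jS iS; apply/contraT => nR.
have tr x : deg (move_set S (replace i j S) K) x + (x == j) = deg K x + (x == i).
  exact: deg_move_set.
have [maj []] := transfer_majorizes lt_ij tr.
by apply: maxK => //; apply: kfamily_move_set.
Qed.

(* If [deg L] strictly majorizes the nonincreasing sequence [deg K], then moving
   one unit of degree from some p to some q > p keeps it majorizing.  There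
   are two different ways of doing so on the level of sets, hence the last
   sequence before [deg K] leads to two realizations of [deg K]. *)
Lemma unique_deg_max k K : kfamily k K ->
  (forall i j, i <= j -> deg K j <= deg K i) -> unique_deg k K -> max_deg k K.
Proof.
move=> KP mono UR L LP majL; apply/eqfunP/contraT => neq; exfalso.
(* The induction is on the sum of all prefix sums of [deg L], which every move from p to a later q
   lowers. *)
have [N leN] := ubnP (\sum_i prefix_sum (deg L) i).
elim: N => // N IHN in L LP majL neq leN *.
have [sumL prefL] := majL.
have [q0 q0P] : exists q, deg L q < deg K q.
  apply/existsP/contraT; rewrite negb_exists => /forallP leKL.
  case/forallPn: neq => i /eqP neqi.
  suff : \sum_j deg K j < \sum_j deg L j by rewrite sumL ltnn.
  rewrite (bigD1 i) // [X in _ < X](bigD1 i) //= -addSn leq_add //.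
    by have := leKL i; lia.
  by apply: leq_sum => j _; rewrite leqNgt leKL.
(* Take the first q at which [L] falls short of [K]. The prefix sum at q then forces a surplus at
   some p < q. *)
case: (@arg_minnP _ q0 (fun q => deg L q < deg K q) val q0P) => q {q0 q0P} ltq minq.
have geq j : j < q -> deg K j <= deg L j.
  by move=> ltjq; rewrite leqNgt; apply/negP => /minq; rewrite leqNgt ltjq.
have [p lt_pq ltp] : exists2 p : 'I_n, p < q & deg K p < deg L p.
  apply/exists_inP/contraT; rewrite negb_exists_in => /forall_inP H.
  have := prefL q; rewrite /prefix_sum (bigD1 q) // [X in _ <= X](bigD1 q) //=.
  rewrite (eq_bigr (deg L)); first lia.
  move=> j /andP[lejq nejq]; have ltjq : j < q by rewrite ltn_neqAle nejq.
  by apply/eqP; rewrite eqn_leq geq //= leqNgt H.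
have le_deg : deg L q + 2 <= deg L p by have := mono p q (ltnW lt_pq); lia.
(* Here deg L q < deg K q <= deg K p < deg L p. The gap of at least 2 leaves at least two members of
   [L] in which p can be exchanged for q. *)
pose X := [set S in only L p q | replace q p S \notin L].
have /card_gt1P[S [T [SX TX nST]]] : 1 < #|X|.
  by have := leq_only L q p; have := deg_only L p q; rewrite -/X; lia.
pose M U := move_set U (replace q p U) L.
have MP U : U \in X -> [/\ kfamily k (M U), U \in L, U \notin M U &
     forall x, deg (M U) x + (x == p) = deg L x + (x == q)].
  rewrite !inE => /andP[/and3P[UL pU qU] nR]; split=> //.
  - exact: kfamily_move_set.
  - rewrite ?inE eqxx /=; apply: contra qU => /eqP{1}->.
    by rewrite !inE eqxx.
  - by move=> x; apply: deg_move_set.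
have pre U i : U \in X ->
    prefix_sum (deg (M U)) i + (p <= i) = prefix_sum (deg L) i + (q <= i).
  by case/MP=> _ _ _ /(sum_transfer (fun j => j <= i)).
have majM U : U \in X -> deg_majorizes (M U) K.
  move=> UX; have [_ _ _ tr] := MP U UX; split.
    by have := sum_transfer predT tr; rewrite /= sumL => /addIn.
  move=> i; have := pre U i UX; have := prefL i.
  case: (leqP q i) => [le_qi|lt_iq]; first by rewrite (leq_trans (ltnW lt_pq) le_qi); lia.
  case: (leqP p i) => [le_pi|]; last lia.
  suff : prefix_sum (deg K) i < prefix_sum (deg L) i by lia.
  rewrite /prefix_sum (bigD1 p) // [X in _ < X](bigD1 p) //= -addSn leq_add //.
  by apply: leq_sum => j /andP[le_ji _]; apply/geq/(leq_ltn_trans le_ji).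
(* By induction no family with degrees other than those of [K] can remain after a move, so each of
   the moves ends in [K] itself. *)
have degM U : U \in X -> M U = K.
  move=> UX; have [MU _ _ _] := MP U UX; apply: UR => //; apply/eqfunP/contraT => nM.
  exfalso; apply: (IHN (M U)) => //; first exact: majM.
  rewrite -ltnS; apply: leq_trans leN; rewrite ltnS (bigD1 p) // [X in _ < X](bigD1 p) //=.
  rewrite -addSn leq_add //; first by have := pre U p UX; rewrite leqnn leqNgt lt_pq; lia.
  apply: leq_sum => i _; have := pre U i UX.
  by case: (leqP q i) => [le_qi|]; [rewrite (leq_trans (ltnW lt_pq) le_qi)|]; lia.
(* Both moves give [K], but [S] is absent from [M S] and still present in [M T]. *)
have [_ SL SM _] := MP S SX; move: SM; rewrite (degM S SX) -(degM T TX).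
by rewrite !inE SL (negbTE nST).
Qed.

Lemma unique_deg_isomorphic_max k K : 0 < k -> kfamily k K -> unique_deg k K ->
  exists2 K', isomorphic K K' & max_deg k K'.
Proof.
move=> k_gt0 KP UR; have [p pP] := sort_perm (deg K).
have degP i : deg (relabel p^-1 K) i = deg K (p i).
  by rewrite -(deg_relabel p^-1 K) permK.
exists (relabel p^-1 K); first by exists (p^-1)%g.
apply: unique_deg_max; first exact: kfamily_relabel.
  by move=> i j le_ij; rewrite !degP pP.
move=> L LP degL; rewrite -(UR (relabel p L)) ?relabelK ?kfamily_relabel //.
by move=> i; rewrite -[i](permKV p) deg_relabel degL degP.
Qed.

(* The degrees of a compressed family decrease, so its degree sequence is the
   sorted rearrangement of that of [K]. *)
Lemma isomorphic_max_deg k K K' : kfamily k K -> compressed K ->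
  isomorphic K K' -> max_deg k K' -> max_deg k K.
Proof.
move=> KP cK [s eK'] maxK'; rewrite -/(relabel s K) in eK'.
have KP' : kfamily k K' by rewrite -eK' kfamily_relabel.
have cK' := max_deg_compressed KP' maxK'.
have eqdeg : deg K' =1 deg K.
  apply: (@sorted_perm_eq _ _ _ s) => [i j|i j|i].
  - exact: compressed_deg.
  - exact: compressed_deg.
  - by rewrite -eK' deg_relabel.
move=> L LP majL i; rewrite -eqdeg; apply: maxK' => //.
case: majL => sumL prefL; split; first by rewrite sumL; apply: eq_bigr => j _.
by move=> j; rewrite {1}/prefix_sum (eq_bigr (deg K)) //; apply: prefL.
Qed.

End Majorization.

(** * Gordan's alternative *)

Section FourierMotzkin.
Variable F : realFieldType.
Local Open Scope ring_scope.

Lemma lt_all_above (x : F) (U : seq F) : {in U, forall y, x < y} ->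
  exists2 z, x < z & {in U, forall y, z < y}.
Proof.
elim: U => [_|y U IHU xU]; first by exists (x + 1); rewrite ?ltrDl.
have [z xz zU] : exists2 z, x < z & {in U, forall y, z < y}.
  by apply: IHU => u uU; apply: xU; rewrite inE uU orbT.
have xy : x < y by apply: xU; apply: mem_head.
exists (Num.min z ((x + y) / 2)); first by rewrite lt_min xz /=; lra.
move=> u; rewrite inE => /predU1P[->|/zU zu]; first by rewrite gt_min; lra.
by rewrite gt_min zu.
Qed.

(** Supplies the value of the eliminated coordinate from its lower bounds [L] and upper bounds [U];
    either list may be empty. *)
Lemma exists_between (L U : seq F) : {in L & U, forall x y, x < y} ->
  exists z, {in L, forall x, x < z} /\ {in U, forall y, z < y}.
Proof.
move=> LU; suff [m Lm mU] : exists2 m, {in L, forall x, x <= m} & {in U, forall y, m < y}.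
  have [z mz zU] := lt_all_above mU; exists z; split=> // x /Lm xm.
  exact: le_lt_trans mz.
elim: L LU => [_|x L IHL LU].
  elim: U => [|y U [m _ mU]]; first by exists 0.
  exists (Num.min m (y - 1)) => // u; rewrite inE gt_min => /predU1P[->|/mU->//].
  by rewrite gtrBl ltr01 orbT.
have [a b aL bU|m Lm mU] := IHL; first by apply: LU; rewrite // inE aL orbT.
exists (Num.max x m) => [a|y yU].
  by rewrite inE le_max => /predU1P[->|/Lm->]; rewrite ?lexx ?orbT.
by rewrite gt_max mU // LU ?mem_head.
Qed.

Variable n : nat.
Implicit Types (l s : seq 'rV[int]_n) (u v : 'rV[int]_n).

(** Truncating the product, rather than the vectors, lets the induction on r stay in one vector
    type. *)
Definition dot_upto (r : nat) (w : 'I_n -> F) u : F :=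
  \sum_(i < n | (i < r)%N) w i * (u 0 i)%:~R.

Lemma dot_uptoD r w u v : dot_upto r w (u + v) = dot_upto r w u + dot_upto r w v.
Proof.
by rewrite /dot_upto -big_split; apply: eq_bigr => i _; rewrite mxE rmorphD mulrDr.
Qed.

Lemma dot_uptoMn r w u m : dot_upto r w (u *+ m) = dot_upto r w u *+ m.
Proof.
elim: m => [|m IHm]; last by rewrite !mulrS dot_uptoD IHm.
by rewrite !mulr0n /dot_upto big1 // => i _; rewrite mxE mulr0.
Qed.

Lemma dot_uptoS (r : 'I_n) (w : 'I_n -> F) x u :
  dot_upto r.+1 (fun i => if i == r then x else w i) u =
  x * (u 0 r)%:~R + dot_upto r w u.
Proof.
rewrite /dot_upto (bigD1 r) //= eqxx; congr (_ + _).
apply: eq_big => [i|i /andP[_ /negbTE-> //]].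
by rewrite ltnS -val_eqE /= andbC ltn_neqAle.
Qed.

(** Cancels coordinate r when the entries of u and v there have opposite signs. The coefficients are
    natural numbers, so the result is again a sum of vectors with repetition. *)
Definition combine (r : 'I_n) u v := u *+ absz (v 0%R r) + v *+ absz (u 0%R r).

Definition eliminate (r : 'I_n) l :=
  [seq u : 'rV[int]_n <- l | u 0 r == 0] ++
  [seq combine r u v | u <- [seq u : 'rV[int]_n <- l | 0 < u 0 r],
                     v <- [seq v : 'rV[int]_n <- l | v 0 r < 0]].

Lemma eliminateP r l (x : 'rV[int]_n) : x \in eliminate r l ->
  x 0 r = 0 /\ exists s, [/\ s != [::], {subset s <= l} & x = \sum_(u <- s) u].
Proof.
rewrite mem_cat mem_filter => /orP[/andP[/eqP x0 xl]|].
  split=> //; exists [:: x]; split=> //; last by rewrite big_seq1.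
  by move=> u; rewrite inE => /eqP->.
case/allpairsP=> -[u v] /= []; rewrite !mem_filter => /andP[u0 ul] /andP[v0 vl] ->.
split.
  rewrite /combine mxE !mulmxnE -[X in X + _]mulr_natr -[X in _ + X]mulr_natr.
  rewrite !natz !abszE (gtr0_norm u0) (ltr0_norm v0).
  by rewrite mulrN mulrC addNr.
exists (nseq (absz (v 0%R r)) u ++ nseq (absz (u 0%R r)) v); split.
- by rewrite -size_eq0 size_cat !size_nseq addn_eq0 !absz_eq0 lt_eqF.
- by move=> y; rewrite mem_cat !mem_nseq => /orP[]/andP[_ /eqP->].
- by rewrite big_cat !big_nseq -!Monoid.iteropE.
Qed.

(* Gordan's alternative, with the dependency written as a multiset of vectors;
   the coordinates are eliminated one at a time. *)
Lemma gordan_upto r l : (r <= n)%N ->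
  (exists w, {in l, forall u, 0 < dot_upto r w u}) \/
  (exists s, [/\ s != [::], {subset s <= l} &
     forall i : 'I_n, (i < r)%N -> (\sum_(u <- s) u) 0 i = 0]).
Proof.
elim: r l => [|r IHr] l ltrn.
  case: l => [|u l]; first by left; exists (fun => 0).
  by right; exists [:: u]; split=> // x; rewrite !inE => ->.
pose r' := Ordinal ltrn; have [[w wP]|[s [s0 sl sP]]] := IHr (eliminate r' l) (ltnW ltrn).
  left; pose g u := dot_upto r w u.
  (* The new coordinate x must exceed - g u / u_r when u_r > 0 and stay below - g v / v_r when v_r <
     0. Positivity on [combine r' u v] says that such bounds are compatible. *)
  have gP u v : u \in l -> v \in l -> 0 < u 0 r' -> v 0 r' < 0 ->
      - g u / (u 0 r')%:~R < - g v / (v 0 r')%:~R.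
    move=> ul vl u0 v0; have /wP : combine r' u v \in eliminate r' l.
      rewrite mem_cat; apply/orP; right; apply/allpairsP; exists (u, v).
      by rewrite !mem_filter u0 v0.
    rewrite /combine dot_uptoD !dot_uptoMn -/(g u) -/(g v).
    have -> : g u *+ absz (v 0%R r') = - g u * (v 0 r')%:~R.
      by rewrite -[LHS]mulr_natr natr_absz (ltr0_norm v0) rmorphN mulrN mulNr.
    have -> : g v *+ absz (u 0%R r') = g v * (u 0 r')%:~R.
      by rewrite -[LHS]mulr_natr natr_absz gtr0_norm.
    have uF : 0 < (u 0 r')%:~R :> F by rewrite ltr0z.
    have vF : (v 0 r')%:~R < 0 :> F by rewrite ltrz0.
    by rewrite ltr_pdivrMr // mulrAC ltr_ndivlMr // => ?; lra.
  have [|x [xL xU]] := @exists_between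
      [seq - g u / (u 0 r')%:~R | u : 'rV[int]_n <- l & 0 < u 0 r']
      [seq - g u / (u 0 r')%:~R | u : 'rV[int]_n <- l & u 0 r' < 0].
    move=> _ _ /mapP[u + ->] /mapP[v + ->]; rewrite !mem_filter.
    by move=> /andP[? ?] /andP[? ?]; apply: gP.
  exists (fun i => if i == r' then x else w i) => u ul.
  rewrite (dot_uptoS r') -/(g u).
  have [u0|u0|u0] := ltgtP (u 0 r') 0.
  - have uF : (u 0 r')%:~R < 0 :> F by rewrite ltrz0.
    have : x < - g u / (u 0 r')%:~R by apply: xU; apply/mapP; exists u; rewrite // mem_filter u0.
    by rewrite ltr_ndivlMr // => ?; lra.
  - have uF : 0 < (u 0 r')%:~R :> F by rewrite ltr0z.
    have : - g u / (u 0 r')%:~R < x by apply: xL; apply/mapP; exists u; rewrite // mem_filter u0.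
    by rewrite ltr_pdivrMr // => ?; lra.
  - by rewrite u0 mulr0 add0r; apply: wP; rewrite mem_cat mem_filter u0 eqxx ul.
(* Every eliminated vector is a nonempty sum of vectors of [l]; substituting these sums turns the
   dependency into one over [l]. *)
right; suff [s' [s'0 s'l s'E]] : exists s', [/\ s' != [::], {subset s' <= l} &
    \sum_(u <- s') u = \sum_(u <- s) u].
  exists s'; split=> // i; rewrite s'E ltnS leq_eqVlt => /predU1P[eir|/sP//].
  have -> : i = r' by apply: val_inj.
  rewrite summxE big_seq big1 // => u /sl; by case/eliminateP.
elim: s s0 sl {sP} => // x s IHs _ sl.
have /eliminateP[_ [sx [sx0 sxl ->]]] := sl x (mem_head _ _).
have [->|s0] := eqVneq s [::]; first by exists sx; rewrite big_seq1.
have [|s' [s'0 s'l s'E]] := IHs s0; first by move=> y ys; apply: sl; rewrite inE ys orbT.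
exists (sx ++ s'); split; first by case: (sx) sx0.
  by move=> y; rewrite mem_cat => /orP[/sxl|/s'l].
by rewrite big_cat big_cons s'E.
Qed.

Lemma gordan l :
  (exists w : 'I_n -> F, {in l, forall u, 0 < \sum_i w i * (u 0 i)%:~R}) \/
  (exists s, [/\ s != [::], {subset s <= l} & \sum_(u <- s) u = 0]).
Proof.
have [[w wP]|[s [s0 sl sE]]] := gordan_upto l (leqnn n).
  left; exists w => u /wP; rewrite /dot_upto.
  by under eq_bigl do rewrite ltn_ord.
by right; exists s; split=> //; apply/rowP => i; rewrite sE // mxE.
Qed.

End FourierMotzkin.

(** * Thresholds and vertices *)

Section RealConditions.
Variables (R : realType) (n k : nat).
Implicit Types (K L : {set {set 'I_n}}) (S : {set 'I_n}).
Local Open Scope ring_scope.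

Lemma degseq_deg K i : degseq R K 0 i = (deg K i)%:R.
Proof. by rewrite mxE. Qed.

Lemma degseq_eqP K L : degseq R K = degseq R L <-> deg K =1 deg L.
Proof.
split=> [/rowP eKL i | eKL]; last by apply/rowP => i; rewrite !degseq_deg eKL.
by apply/eqP; have /eqP := eKL i; rewrite !degseq_deg eqr_nat.
Qed.

Lemma sum_chi (s : seq {set 'I_n}) i :
  (\sum_(S <- s) chi R S) 0 i = (count (fun S => i \in S) s)%:R.
Proof.
rewrite summxE -sum1_count natr_sum [RHS]big_mkcond; apply: eq_bigr => S _.
by rewrite mxE; case: ifP.
Qed.

Lemma sum_chi_eqP (s t : seq {set 'I_n}) :
  \sum_(S <- s) chi R S = \sum_(S <- t) chi R S <->
  forall i, count (fun S => i \in S) s = count (fun S => i \in S) t.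
Proof.
split=> [/rowP eq_st i | eq_st]; last by apply/rowP => i; rewrite !sum_chi eq_st.
by apply/eqP; have /eqP := eq_st i; rewrite !sum_chi eqr_nat.
Qed.

Lemma CC_trade_robust K :
  (forall t, (1 <= t)%N -> CC R k t K) <-> trade_robust k K.
Proof.
split=> [ccK A B sz0 /eqP szAB AP BP /sum_chi_eqP eqAB sAK | tK t t0 A B AP BP].
  rewrite eq_sym in szAB.
  exact: (ccK _ sz0 (in_tuple A) (Tuple szAB) AP BP eqAB sAK).
by move=> /sum_chi_eqP eqAB sAK; apply: (tK A B); rewrite ?size_tuple.
Qed.

Lemma DCC_trade_robust K :
  (forall t, (1 <= t)%N -> DCC R k t K) <-> distinct_trade_robust k K.
Proof.
split=> [ccK A B uA uB sz0 /eqP szAB AP BP /sum_chi_eqP eqAB sAK | tK t t0 A B uA uB AP BP].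
  rewrite eq_sym in szAB.
  exact: (ccK _ sz0 (in_tuple A) (Tuple szAB) uA uB AP BP eqAB sAK).
by move=> /sum_chi_eqP eqAB sAK; apply: (tK A B); rewrite ?size_tuple.
Qed.

Lemma uniquely_realizable_deg K : uniquely_realizable R k K <-> unique_deg k K.
Proof.
split=> [uK L LP /degseq_eqP eqLK | uK [L [LP nLK /degseq_eqP/uK]]]; last by auto.
by apply/eqP/contraT => /eqP nLK; case: uK; exists L.
Qed.

Lemma majorizes_deg K L :
  majorizes (degseq R L) (degseq R K) <-> deg_majorizes L K.
Proof.
have E (P : pred 'I_n) M : \sum_(j < n | P j) degseq R M 0 j = (\sum_(j < n | P j) deg M j)%:R.
  by rewrite natr_sum; apply: eq_bigr => j _; rewrite degseq_deg.
split=> -[sumE prefE]; split.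
- by apply/eqP; move/eqP: sumE; rewrite !E eqr_nat.
- by move=> i; move: (prefE i); rewrite !E ler_nat.
- by rewrite !E sumE.
- by move=> i; rewrite !E ler_nat; apply: prefE.
Qed.

Lemma degree_maximal_deg K : degree_maximal R k K <-> max_deg k K.
Proof.
split=> [mK L LP majL | mK [L [LP _ [/majorizes_deg majL neq]]]].
  apply/eqfunP/contraT => neq; case: mK; exists L; split=> //.
    by move=> eLK; case/eqfunP: neq => i; rewrite eLK.
  split; first exact/majorizes_deg.
  by move=> /degseq_eqP /eqfunP; rewrite (negbTE neq).
by apply: neq; apply/degseq_eqP/mK.
Qed.

Lemma isomorphic_degree_maximal K :
  (exists2 K', isomorphic K K' & degree_maximal R k K') <->
  (exists2 K', isomorphic K K' & max_deg k K').
Proof. by split=> -[K' isoK /degree_maximal_deg mK]; exists K'. Qed.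

Definition dot (c : 'I_n -> R) (x : 'rV[R]_n) : R := \sum_i c i * x 0 i.

Lemma dot_is_linear c : linear_for *%R (dot c).
Proof.
move=> a x y; rewrite /dot big_distrr -big_split; apply: eq_bigr => i _ /=.
by rewrite !mxE; ring.
Qed.

(** Makes [dot c] available as the linear functional that [threshold] asks for. *)
HB.instance Definition _ c :=
  GRing.isLinear.Build R 'rV[R]_n R *%R (dot c) (dot_is_linear c).

Lemma dot_chi c S : dot c (chi R S) = \sum_(i in S) c i.
Proof.
rewrite /dot [RHS]big_mkcond; apply: eq_bigr => i _; rewrite mxE.
by case: ifP; rewrite ?mulr1 ?mulr0.
Qed.

Lemma chi_delta S : chi R S = \sum_(i in S) delta_mx 0 i.
Proof.
apply/rowP => j; rewrite mxE summxE; have [jS|jS] := boolP (j \in S).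
  rewrite (bigD1 j) //= mxE !eqxx big1 ?addr0 // => i /andP[_ nij].
  by rewrite mxE eq_sym (negbTE nij) andbF.
rewrite big1 // => i iS; rewrite mxE andTb; case: eqP => // eji.
by rewrite eji iS in jS.
Qed.

Lemma thresholdP K : threshold R k K <-> exists c : 'I_n -> R,
  forall S, #|S| = k -> (S \in K <-> 0 < \sum_(i in S) c i).
Proof.
split=> [[w wP]|[c cP]].
  exists (fun i => w (delta_mx 0 i)) => S /eqP Sk.
  by rewrite (wP S Sk) chi_delta raddf_sum.
by exists (dot c) => S /eqP Sk; rewrite cP //= dot_chi.
Qed.

Lemma setwise_positive K : kfamily k K ->
  setwise_positive_threshold R K -> positive_threshold R k K.
Proof.
move=> /kfamilyP KP [c [t [c0 t0 cP]]]; exists c, t; split=> // S /eqP Sk.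
rewrite -cP; split=> [SK|[A AK sAS]]; first by exists S.
by have /eqP <- : A == S by rewrite eqEcard sAS Sk KP /=.
Qed.

Lemma positive_threshold_threshold K : (0 < k)%N ->
  positive_threshold R k K -> threshold R k K.
Proof.
move=> k0 [c [t [_ _ cP]]]; apply/thresholdP.
(* The threshold is spread evenly over the k elements of a set. *)
exists (fun i => c i - t / k%:R) => S Sk; rewrite cP /ksubset ?Sk // -subr_gt0.
rewrite sumrB sumr_const Sk -[(t / _) *+ _]mulr_natr divfK //.
by rewrite pnatr_eq0 -lt0n.
Qed.

Lemma dot_degseq c K : dot c (degseq R K) = \sum_(S in K) \sum_(i in S) c i.
Proof.
rewrite /dot (eq_bigr (fun i => \sum_(S in K) c i * (i \in S)%:R)); last first.
  by move=> i _; rewrite degseq_deg degE natr_sum big_distrr.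
rewrite exchange_big; apply: eq_bigr => S _; rewrite [RHS]big_mkcond.
by apply: eq_bigr => i _; case: ifP; rewrite ?mulr1 ?mulr0.
Qed.

(** Choose e > 0 below the finitely many weights of members and subtract e / k from every
    coefficient. Members stay positive, and the other k-sets, of weight at most 0, drop to at most -
    e. *)
Lemma threshold_strict K : (0 < k)%N -> threshold R k K ->
  exists c : 'I_n -> R, forall S, #|S| = k ->
  if S \in K then 0 < \sum_(i in S) c i else \sum_(i in S) c i < 0.
Proof.
move=> k0 /thresholdP[c cP]; pose wt S := \sum_(i in S) c i.
have [e e0 eP] : exists2 e : R, 0 < e &
    {in [seq wt T | T : {set 'I_n} <- enum K & #|T| == k], forall y, e < y}.
  apply: lt_all_above => _ /mapP[S + ->]; rewrite mem_filter mem_enum.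
  by move=> /andP[/eqP Sk SK]; apply/cP.
exists (fun i => c i - e / k%:R) => S Sk.
rewrite sumrB sumr_const Sk -[(e / _) *+ _]mulr_natr divfK ?pnatr_eq0 -?lt0n //.
rewrite subr_gt0 subr_lt0; case: ifP => SK.
  by apply: eP; apply/mapP; exists S; rewrite // mem_filter Sk eqxx mem_enum.
by apply: le_lt_trans e0; rewrite leNgt; apply/negP => /cP; rewrite SK => /(_ Sk).
Qed.

Lemma degree_polytope_degseq K : kfamily k K -> degree_polytope R n k (degseq R K).
Proof.
move=> KP; exists 1%N, (fun => 1), (fun => degseq R K); split=> //.
- by rewrite big_ord1.
- by move=> _; exists K.
- by rewrite big_ord1 scale1r.
Qed.

Lemma threshold_vertex K : (0 < k)%N -> kfamily k K ->
  threshold R k K -> vertex (degree_polytope R n k) (degseq R K).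
Proof.
move=> k0 KP /(threshold_strict k0)[c cP].
split=> [|y z t Py Pz /andP[t0 t1] eK]; first exact: degree_polytope_degseq.
pose wt S := \sum_(i in S) c i.
(* Passing from [K] to [L] loses sets of positive weight and gains sets of negative weight. *)
have maxK L : kfamily k L -> L != K -> dot c (degseq R L) < dot c (degseq R K).
  move=> /kfamilyP LP nLK; rewrite !dot_degseq (big_setID K) [ltRHS](big_setID L) /=.
  rewrite setIC ltrD2l.
  have posK S : S \in K :\: L -> 0 < wt S.
    rewrite inE => /andP[_ SK]; have := cP S; rewrite SK; apply.
    by move/kfamilyP: KP; apply.
  have negL S : S \in L :\: K -> wt S < 0.
    rewrite inE => /andP[/negbTE nSK SL]; have := cP S; rewrite nSK; apply.
    exact: LP.
  have leL : \sum_(S in L :\: K) wt S <= 0 by apply: sumr_le0 => S /negL/ltW.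
  have geK : 0 <= \sum_(S in K :\: L) wt S by apply: sumr_ge0 => S /posK/ltW.
  rewrite -/(wt _) lt_neqAle (le_trans leL geK) andbT; apply/eqP => E.
  have sumK : \sum_(S in K :\: L) wt S = 0 by apply/eqP; rewrite eq_le geK andbT -E.
  have sumL : \sum_(S in L :\: K) wt S = 0 by rewrite E.
  case/eqP: nLK; apply/setP => S; apply/idP/idP => [SL|SK]; apply/contraT => nS.
    have SLK : S \in L :\: K by rewrite inE nS.
    have := negL S SLK; have := sumL; rewrite (bigD1 S) //= => E0.
    suff : \sum_(i in L :\: K | i != S) wt i <= 0 by lra.
    by apply: sumr_le0 => T /andP[/negL/ltW].
  have SKL : S \in K :\: L by rewrite inE nS.
  have := posK S SKL; have := sumK; rewrite (bigD1 S) //= => E0.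
  suff : 0 <= \sum_(i in K :\: L | i != S) wt i by lra.
  by apply: sumr_ge0 => T /andP[/posK/ltW].
(* A convex combination attains the maximum only if all its points with nonzero coefficient are
   [degseq R K]. *)
have hullP x : degree_polytope R n k x ->
    dot c x <= dot c (degseq R K) /\ (dot c x = dot c (degseq R K) -> x = degseq R K).
  case=> m [a [p [a0 a1 pP ->]]].
  have pK i : p i = degseq R K \/ dot c (p i) < dot c (degseq R K).
    have [L LP ->] := pP i; have [->|/(maxK L LP)] := eqVneq L K; [by left|by right].
  have dK : dot c (degseq R K) = \sum_(i < m) a i * dot c (degseq R K).
    by rewrite -big_distrl /= a1 mul1r.
  have dx : dot c (\sum_(i < m) a i *: p i) = \sum_(i < m) a i * dot c (p i).
    by rewrite raddf_sum; apply: eq_bigr => i _; rewrite /= linearZ.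
  have le_i i : a i * dot c (p i) <= a i * dot c (degseq R K).
    by rewrite ler_wpM2l //; case: (pK i) => [->|/ltW].
  split; first by rewrite dx [leRHS]dK; apply: ler_sum => i _.
  rewrite dx [RHS]dK => /eqP; rewrite eq_sym -subr_eq0 -sumrB psumr_eq0; last first.
    by move=> i _; rewrite subr_ge0.
  move=> /allP E; rewrite -[RHS]scale1r -a1 scaler_suml; apply: eq_bigr => i _.
  have := E i; rewrite mem_index_enum => /(_ isT) /=; rewrite -mulrBr mulf_eq0.
  case/orP=> [/eqP->|]; first by rewrite !scale0r.
  by case: (pK i) => [->//|]; rewrite -subr_gt0 => /lt0r_neq0/negbTE->.
have [ley eqy] := hullP y Py; have [lez eqz] := hullP z Pz.
have E : dot c (degseq R K) = t * dot c y + (1 - t) * dot c z.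
  by rewrite {1}eK raddfD /= !linearZ.
by split; [apply: eqy | apply: eqz]; nra.
Qed.

Lemma average_degree_polytope (s : seq {set {set 'I_n}}) :
  (0 < size s)%N -> {in s, forall K, kfamily k K} ->
  degree_polytope R n k ((size s)%:R^-1 *: \sum_(K <- s) degseq R K).
Proof.
move=> s0 sP; exists (size s), (fun => (size s)%:R^-1), (fun i => degseq R (tnth (in_tuple s) i)).
split=> [i||i|].
- by rewrite invr_ge0 ler0n.
- by rewrite sumr_const card_ord -[LHS]mulr_natr mulVf // pnatr_eq0 -lt0n.
- by exists (tnth (in_tuple s) i) => //; apply/sP/mem_tnth.
- by rewrite -scaler_sumr big_tnth.
Qed.

(* Deleting the [A_i] one at a time and adding the [B_i] one at a time gives
   families whose degree sequences average to that of [K]. *)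
Lemma vertex_trade_robust K : (0 < k)%N -> kfamily k K ->
  vertex (degree_polytope R n k) (degseq R K) -> trade_robust k K.
Proof.
move=> k0 KP [_ vK] A B sz0 szAB AP BP /sum_chi_eqP eqAB sAK.
have [/hasP[S SB SK] | /hasPn nBK] := boolP (has (mem K) B); first by exists S.
exfalso; pose t := (size A)%:R : R.
have t0 : t != 0 by rewrite pnatr_eq0 -lt0n.
have chi1 S : degseq R [set S] = chi R S.
  by apply/rowP => i; rewrite degseq_deg degE big_set1 mxE.
have degU S : S \notin K -> degseq R (S |: K) = degseq R K + chi R S.
  move=> nS; rewrite -chi1; apply/rowP => i; rewrite [RHS]mxE !degseq_deg -natrD setUC.
  by rewrite deg_setU // disjoint_sym disjoints1.
have degD S : S \in K -> degseq R (K :\ S) = degseq R K - chi R S.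
  move=> SK; rewrite -chi1; suff -> : degseq R K = degseq R (K :\ S) + degseq R [set S].
    by rewrite addrK.
  apply/rowP => i; rewrite [RHS]mxE !degseq_deg -natrD (deg_setID K [set S]).
  by rewrite (setIidPr _) ?sub1set // addnC.
pose y := t^-1 *: \sum_(L <- [seq K :\ T | T <- A]) degseq R L.
pose z := t^-1 *: \sum_(L <- [seq T |: K | T <- B]) degseq R L.
have yE : y = degseq R K - t^-1 *: \sum_(S <- A) chi R S.
  rewrite /y big_map big_seq (eq_bigr (fun S => degseq R K - chi R S)); last first.
    by move=> S SA; apply/degD/sAK.
  rewrite -big_seq sumrB big_const_seq count_predT iter_addr addr0 scalerBr.
  by rewrite -scaler_nat scalerA mulVf // scale1r.
have zE : z = degseq R K + t^-1 *: \sum_(S <- A) chi R S.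
  rewrite /z big_map big_seq (eq_bigr (fun S => degseq R K + chi R S)); last first.
    by move=> S SB; apply/degU/nBK.
  rewrite -big_seq big_split /= big_const_seq count_predT iter_addr addr0 scalerDr.
  by rewrite -scaler_nat -szAB scalerA mulVf // scale1r eqAB.
have [||||] := vK y z (2^-1).
- have := @average_degree_polytope [seq K :\ T | T <- A]; rewrite size_map; apply=> //.
  move=> _ /mapP[S SA ->]; apply/kfamilyP => T; rewrite inE => /andP[_].
  by move/kfamilyP: KP; apply.
- have := @average_degree_polytope [seq T |: K | T <- B]; rewrite size_map -szAB; apply=> //.
  move=> _ /mapP[S SB ->]; apply/kfamilyP => T; rewrite !inE => /orP[/eqP->|].
    by apply/eqP; apply: (allP BP).
  by move/kfamilyP: KP; apply.
- lra.
- by rewrite yE zE; apply/rowP => i; rewrite !mxE; lra.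
(* The segment is degenerate only if the indicator vectors of [A] sum to zero, which is impossible
   since k > 0. *)
rewrite yE => /eqP; rewrite -subr_eq0 addrAC subrr add0r oppr_eq0 scaler_eq0 invr_eq0.
rewrite (negbTE t0) /= => /eqP sum0 _.
case: A sz0 AP sum0 {szAB eqAB sAK t t0 y z yE zE} => // S A _ /andP[/eqP Sk _] sum0.
have [i iS] : exists i, i \in S by apply/set0Pn; rewrite -card_gt0 Sk.
have := sum_chi (S :: A) i; rewrite sum0 mxE /= iS => /eqP.
by rewrite eq_sym pnatr_eq0.
Qed.

(** Gordan's alternative is applied to the vectors [v S], the indicator vectors with the sign
    reversed outside [K]. A functional positive on all of them is a threshold; a dependency splits
    into members [A] and non-members [B] with equal counts, which is a violated trade. *)
Lemma trade_robust_threshold K : (0 < k)%N -> trade_robust k K -> threshold R k K.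
Proof.
move=> k0 tK; apply/thresholdP.
pose v S : 'rV[int]_n := \row_i (if S \in K then (i \in S)%:R else - (i \in S)%:R).
have [[w wP]|[s [s0 sl sE]]] := gordan R [seq v T | T <- enum [set: {set 'I_n}] & ksubset k T].
  exists w => S Sk; have /wP : v S \in [seq v T | T <- enum [set: {set 'I_n}] & ksubset k T].
    by apply/mapP; exists S; rewrite // mem_filter /ksubset Sk eqxx mem_enum inE.
  have E : \sum_(i in S) w i = \sum_i w i * (i \in S)%:R.
    by rewrite big_mkcond; apply: eq_bigr => i _; case: ifP; rewrite ?mulr1 ?mulr0.
  rewrite E; case: (boolP (S \in K)) => SK.
    rewrite (eq_bigr (fun i => w i * (i \in S)%:R)) // => i _.
    by rewrite mxE SK; case: (i \in S).
  rewrite (eq_bigr (fun i => - (w i * (i \in S)%:R))) => [|i _]; last first.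
    by rewrite mxE (negbTE SK) -mulrN rmorphN; case: (i \in S).
  by rewrite sumrN oppr_gt0 => /ltW; rewrite leNgt => /negbTE->.
exfalso; have [s' s'P es] : exists2 s', all (ksubset k) s' & s = [seq v T | T <- s'].
  elim: s sl {s0 sE} => [|u s IHs] sl; first by exists [::].
  have [|s' s'P ->] := IHs; first by move=> x xs; apply: sl; rewrite inE xs orbT.
  have /mapP[S + ->] := sl u (mem_head _ _); rewrite mem_filter => /andP[Sk _].
  by exists (S :: s') => //=; rewrite Sk.
pose A := [seq T <- s' | T \in K]; pose B := [seq T <- s' | T \notin K].
have Ak : all (ksubset k) A by apply/allP => S; rewrite mem_filter => /andP[_ /(allP s'P)].
have Bk : all (ksubset k) B by apply/allP => S; rewrite mem_filter => /andP[_ /(allP s'P)].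
have cAB i : count (fun S => i \in S) A = count (fun S => i \in S) B.
  have : (\sum_(S <- s') v S) 0 i = 0 by rewrite -(big_map v xpredT id) -es sE mxE.
  rewrite summxE (bigID (mem K)) /= -!(big_filter s').
  have E (t : seq {set 'I_n}) : \sum_(S <- t) (i \in S)%:R =
      (count (fun S => i \in S) t)%:R :> int.
    by rewrite -sum1_count natr_sum [RHS]big_mkcond; apply: eq_bigr => S _; case: ifP.
  rewrite (eq_big_seq (fun S => (i \in S)%:R)) => [|S]; last first.
    by rewrite mem_filter mxE => /andP[->].
  rewrite E (eq_big_seq (F1 := fun S => v S 0 i) (fun S => - (i \in S)%:R)) => [|S]; last first.
    by rewrite mem_filter mxE => /andP[/negbTE->].
  by rewrite sumrN E => /eqP; rewrite subr_eq0 eqr_nat => /eqP.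
have szAB : size A = size B.
  apply/eqP; rewrite -(eqn_pmul2l k0) -!sum_count_mem //.
  by apply/eqP; apply: eq_bigr => i _; apply: cAB.
have sz0 : (0 < size A)%N.
  have : (0 < size s')%N by rewrite -(size_map v) -es; case: (s) s0.
  by rewrite -(count_predC (mem K) s') -!size_filter -/A -/B -szAB addnn double_gt0.
have [|S] := tK A B sz0 szAB Ak Bk cAB.
  by move=> S; rewrite mem_filter => /andP[].
by rewrite mem_filter => /andP[/negbTE->].
Qed.

Lemma trade_robust_distinct K : trade_robust k K -> distinct_trade_robust k K.
Proof. by move=> tK A B _ _; apply: tK. Qed.

End RealConditions.

(** * The case k = 2 *)

Section Graphs.
Variables (n : nat) (K : {set {set 'I_n}}).
Hypothesis K2 : kfamily 2 K.
Hypothesis totK : forall i j, dominates K i j || dominates K j i.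
Implicit Types (x y z u v : 'I_n) (U S A : {set 'I_n}).

Let adj x y := [set x; y] \in K.

Let adjC x y : adj x y = adj y x. Proof. by rewrite /adj setUC. Qed.

Let adj_irr x : adj x x = false.
Proof.
by apply/negP => /(kfamilyP _ _ K2); rewrite setUid cards1.
Qed.

Lemma edgeP A v : A \in K -> v \in A -> exists2 y, y != v & A = [set v; y].
Proof.
move=> /(kfamilyP _ _ K2)/eqP/cards2P[a [b [nab ->]]]; rewrite !inE.
by case/orP=> /eqP->; [exists b; rewrite // eq_sym | exists a; rewrite // setUC].
Qed.

(** If x dominates z, the edge yz gives the edge xy; if z dominates x, the edge xu gives zu. *)
Lemma no_two_switch x y z u : x != y -> z != u ->
  adj y z -> adj x u -> adj x y || adj z u.
Proof.
move=> nxy nzu yz xu; have [//|xyK] /= := boolP (adj x y).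
have nxz : x != z by apply: contraNneq xyK => ->; rewrite adjC.
have nxu : x != u by apply: contraTneq xu => ->; rewrite adj_irr.
have nyz : y != z by apply: contraTneq yz => ->; rewrite adj_irr.
case/orP: (totK x z) => /dominatesP.
  move=> /(_ _ yz); rewrite !inE eqxx orbT (negbTE nxy) (negbTE nxz) => /(_ isT isT).
  rewrite /replace setUC [[set y; z]]setUC setU1K ?inE 1?eq_sym // setUC => xyK'.
  by rewrite /adj xyK' in xyK.
move=> /(_ _ xu); rewrite !inE eqxx (eq_sym z x) (negbTE nxz) (negbTE nzu) => /(_ isT isT).
by rewrite /replace setU1K ?inE.
Qed.

(** Let x have the most neighbours in [U]. If x misses some y, then y is isolated: for a neighbour z
    of y, [no_two_switch] makes every other neighbour of x a neighbour of z, and z also has y, so z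
    would have more neighbours than x. *)
Lemma isolated_or_dominating U : U != set0 -> exists2 v, v \in U &
  {in U, forall y, ~~ adj v y} \/ {in U, forall y, y != v -> adj v y}.
Proof.
case/set0Pn=> x0 x0U; pose N x := [set y in U | adj x y].
have [x xU maxx] := @arg_maxnP _ x0 (mem U) (fun x => #|N x|) x0U; rewrite /= in xU maxx.
have [dom|] := boolP [forall (y | y \in U), (y != x) ==> adj x y].
  by exists x => //; right=> y yU; apply/implyP; move/forall_inP: dom; apply.
rewrite negb_forall_in => /exists_inP[y yU]; rewrite negb_imply => /andP[nyx xy].
exists y => //; left=> z zU; apply/negP => yz.
have nxz : x != z by apply: contraNneq xy => ->; rewrite adjC.
have nyz : y != z by apply: contraTneq yz => ->; rewrite adj_irr.
suff : #|N x| < #|N z| by rewrite ltnNge; have /= -> := maxx z zU.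
rewrite (cardsD1 z (N x)) (cardsD1 x (N z)) !inE xU zU /= (adjC z x) ltn_add2l.
apply: proper_card; apply/properP; split.
  apply/subsetP => u; rewrite !inE => /and3P[nuz uU xu].
  have nux : u != x by apply: contraTneq xu => ->; rewrite adj_irr.
  rewrite nux uU /=; have := @no_two_switch x y z u.
  by rewrite (negbTE xy); apply => //; rewrite eq_sym.
by exists y; rewrite !inE ?nyx ?yU ?(adjC z) ?yz ?(negbTE xy) ?andbF.
Qed.

Lemma graph_weights U : exists (c : 'I_n -> nat) (t : nat),
  [/\ forall i, 0 < c i, 0 < t & forall S, S \subset U ->
      (exists2 A, A \in K & A \subset S) <-> t < \sum_(i in S) c i].
Proof.
have [m leUm] := ubnP #|U|; elim: m => // m IHm in U leUm *.
have [-> | U0] := eqVneq U set0.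
  exists (fun => 1), 1; split=> // S; rewrite subset0 => /eqP->.
  rewrite big_set0; split=> // -[A AK]; rewrite subset0 => /eqP A0.
  by have := kfamilyP _ _ K2 _ AK; rewrite A0 cards0.
have [v vU vP] := isolated_or_dominating U0.
have [|c [t [c0 t0 cP]]] := IHm (U :\ v).
  by move: leUm; rewrite (cardsD1 v) vU.
have cP' S : S \subset U -> (exists2 A, A \in K & A \subset S :\ v) <->
    t < \sum_(i in S :\ v) c i.
  by move=> SU; apply/cP/setSD.
case: vP => [iso|dom].
  (* Doubling leaves a gap at 2 t + 1, so the weight 1 of the isolated vertex never decides. *)
  exists (fun i => if i == v then 1 else 2 * c i), (2 * t + 1).
  split=> [i||S SU]; [by case: ifP; rewrite // muln_gt0 c0 | by rewrite addn1 |].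
  have E : \sum_(i in S) (if i == v then 1 else 2 * c i) =
      (v \in S) + 2 * \sum_(i in S :\ v) c i.
    rewrite big_distrr [LHS](bigID (pred1 v)) /=; congr (_ + _).
      have [vS|vS] := boolP (v \in S).
        rewrite (big_pred1 v) ?eqxx // => i; rewrite /= andbC.
        by case: eqP => // ->.
      by rewrite big1 // => i /andP[iS /eqP eiv]; rewrite -eiv iS in vS.
    by apply: eq_big => [i|i /andP[_ /negbTE->] //]; rewrite !inE andbC.
  rewrite E; transitivity (exists2 A, A \in K & A \subset S :\ v).
    split=> -[A AK sAS]; exists A => //; last by apply: subset_trans sAS (subD1set _ _).
    rewrite subsetD1 sAS; apply/negP => vA; have [y _ eA] := edgeP AK vA.
    have yU : y \in U by apply/(subsetP SU)/(subsetP sAS); rewrite eA !inE eqxx orbT.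
    by have := iso y yU; rewrite /adj -eA AK.
  by rewrite cP' //; case: (v \in S); split; lia.
(* A dominating vertex of weight t stays at the threshold alone and passes it together with any
   other vertex. *)
exists (fun i => if i == v then t else c i), t; split=> // [i|S SU]; first by case: ifP.
have E : \sum_(i in S) (if i == v then t else c i) =
    (v \in S) * t + \sum_(i in S :\ v) c i.
  rewrite [LHS](bigID (pred1 v)) /=; congr (_ + _).
    have [vS|vS] := boolP (v \in S).
      rewrite (big_pred1 v) ?eqxx ?mul1n // => i; rewrite /= andbC.
      by case: eqP => // ->.
    by rewrite big1 // => i /andP[iS /eqP eiv]; rewrite -eiv iS in vS.
  by apply: eq_big => [i|i /andP[_ /negbTE->] //]; rewrite !inE andbC.
rewrite E; have [vS|vS] := boolP (v \in S); last first.
  by rewrite -cP' //; have /setDidPl -> : [disjoint S & [set v]] by rewrite disjoint_sym disjoints1.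
rewrite mul1n -[ltnLHS]addn0 ltn_add2l; split=> [[A AK sAS]|].
  have Av : #|A :\ v| != 0.
    have := kfamilyP _ _ K2 A AK; rewrite (cardsD1 v); case: (v \in A); lia.
  rewrite cards_eq0 in Av; case/set0Pn: Av => y; rewrite !inE => /andP[nyv yA].
  by rewrite (bigD1 y) ?inE ?nyv ?(subsetP sAS) //= addn_gt0 c0.
move=> sum0; have [y] : exists y, y \in S :\ v.
  apply/set0Pn; apply: contraTneq sum0 => ->; by rewrite big_set0.
rewrite !inE => /andP[nyv yS]; exists [set v; y].
  by apply: dom => //; apply: (subsetP SU).
by apply/subsetP => i; rewrite !inE => /orP[]/eqP->.
Qed.

End Graphs.

Lemma graph_setwise_positive_threshold (R : realType) n (K : {set {set 'I_n}}) :
  kfamily 2 K -> (forall i j, dominates K i j || dominates K j i) ->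
  setwise_positive_threshold R K.
Proof.
move=> K2 totK; have [c [t [c0 t0 cP]]] := graph_weights K2 totK setT.
exists (fun i => (c i)%:R%R), t%:R%R; split=> [i||S]; rewrite ?ltr0n //.
by rewrite cP ?subsetT // -natr_sum ltr_nat.
Qed.

(** * Weakly separated families *)

Section WeakSeparation.
Variables (n k : nat) (u : 'I_n -> nat) (T : nat) (K : {set {set 'I_n}}).
Implicit Types (L : {set {set 'I_n}}) (S : {set 'I_n}).

Definition weight S := \sum_(i in S) u i.

Lemma sum_weight L : \sum_(S in L) weight S = \sum_i u i * deg L i.
Proof.
under [RHS]eq_bigr => i _ do rewrite degE big_distrr /=.
rewrite exchange_big; apply: eq_bigr => S _; rewrite /weight big_mkcond.
by apply: eq_bigr => i _; case: ifP; rewrite ?muln1 ?muln0.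
Qed.

Hypothesis KP : kfamily k K.
Hypothesis ltT_K : forall S, #|S| = k -> weight S < T -> S \in K.
Hypothesis K_leT : forall S, S \in K -> weight S <= T.

(** Going from [K] to [L] trades sets of weight at most [T] for equally many of weight at least [T].
    The total cannot drop, and it stays the same only if all traded sets weigh exactly [T]. *)
Lemma weight_min L : kfamily k L -> #|L| = #|K| ->
  \sum_(S in K) weight S <= \sum_(S in L) weight S /\
  (\sum_(S in L) weight S <= \sum_(S in K) weight S ->
   forall S, (S \in L) != (S \in K) -> weight S = T).
Proof.
move=> LP cardLK.
have EK : \sum_(S in K) weight S = \sum_(S in K :&: L) weight S + \sum_(S in K :\: L) weight S.
  by rewrite (big_setID L).
have EL : \sum_(S in L) weight S = \sum_(S in K :&: L) weight S + \sum_(S in L :\: K) weight S.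
  by rewrite (big_setID K) /= setIC.
rewrite EK EL.
have cardD : #|K :\: L| = #|L :\: K|.
  by have := cardsID L K; have := cardsID K L; rewrite cardLK setIC; lia.
have LT S : S \in L :\: K -> T <= weight S.
  rewrite inE => /andP[nSK SL]; rewrite leqNgt; apply: contra nSK; apply: ltT_K.
  by move/kfamilyP: LP; apply.
have KT S : S \in K :\: L -> weight S <= T by rewrite inE => /andP[_ /K_leT].
have leK : \sum_(S in K :\: L) weight S <= #|K :\: L| * T.
  by rewrite -sum_nat_const; apply: leq_sum.
have leL : #|L :\: K| * T <= \sum_(S in L :\: K) weight S.
  by rewrite -sum_nat_const; apply: leq_sum.
rewrite cardD in leK; split; first by rewrite leq_add2l; apply: leq_trans leL.
rewrite leq_add2l => le_LK S; case SL : (S \in L); case SK : (S \in K) => // _.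
  have SLK : S \in L :\: K by rewrite inE SK.
  apply/eqP; rewrite eqn_leq LT // andbT leqNgt; apply/negP => gtT.
  suff : #|L :\: K| * T < \sum_(S in L :\: K) weight S by lia.
  rewrite -sum_nat_const (bigD1 S) // [X in _ < X](bigD1 S) //= -addSn leq_add //.
  by apply: leq_sum => S' /andP[/LT].
have SKL : S \in K :\: L by rewrite inE SL.
apply/eqP; rewrite eqn_leq KT // leqNgt; apply/negP => ltT.
suff : \sum_(S in K :\: L) weight S < #|K :\: L| * T by lia.
rewrite -sum_nat_const (bigD1 S) // [X in _ < X](bigD1 S) //= -addSn leq_add //.
by apply: leq_sum => S' /andP[/KT].
Qed.

(** The total weight depends only on the degrees, so this is the equality case of [weight_min]. *)
Lemma weight_unique_deg L : 0 < k -> kfamily k L -> deg L =1 deg K ->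
  forall S, (S \in L) != (S \in K) -> weight S = T.
Proof.
move=> k0 LP eqLK; have [_] := weight_min LP (deg_card k0 LP KP eqLK); apply.
by rewrite !sum_weight; apply: leq_sum => i _; rewrite eqLK.
Qed.

(** The value at j occurs in n - j prefix sums. This links majorization to the weights u i = i. *)
Lemma sum_prefix_sum (f : 'I_n -> nat) :
  \sum_i prefix_sum f i + \sum_(i < n) i * f i = n * \sum_i f i.
Proof.
rewrite /prefix_sum (exchange_big_dep predT) //= big_distrr -big_split /=.
apply: eq_bigr => j _; rewrite sum_nat_const -mulnDl; congr (_ * _).
rewrite -sum1_card (eq_bigl (fun i : 'I_n => predT (val i) && (j <= i))) //.
rewrite -(big_geq_mkord _ _ predT (fun => 1)) sum_nat_const_nat muln1 subnK //.
exact/ltnW/ltn_ord.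
Qed.

Lemma prefix_sum_inj (f g : 'I_n -> nat) : prefix_sum f =1 prefix_sum g -> f =1 g.
Proof.
move=> fg i; have [m] := ubnP (i : nat); elim: m i => // m IHm i le_im.
have := fg i; rewrite /prefix_sum (bigD1 i) // [RHS](bigD1 i) //=.
rewrite [X in _ + X](eq_bigr g); first exact: addIn.
move=> j /andP[le_ji nji]; apply: IHm; rewrite ltnS in le_im; apply: leq_trans le_im.
by rewrite ltn_neqAle nji.
Qed.

(** Minimal total weight means a maximal sum of prefix sums, so a majorizing sequence cannot exceed
    [deg K] in any prefix sum. *)
Lemma weight_max_deg : 0 < k -> (forall i, u i = i) -> max_deg k K.
Proof.
move=> k0 uE L LP [sumLK prefLK].
have cardLK : #|L| = #|K|.
  by apply/eqP; rewrite -(eqn_pmul2l k0) -!sum_deg // sumLK.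
have [] := weight_min LP cardLK; rewrite !sum_weight => leKL _.
have sumE M : \sum_i u i * deg M i = \sum_(i < n) i * deg M i.
  by apply: eq_bigr => i _; rewrite uE.
rewrite !sumE in leKL.
have := sum_prefix_sum (deg L); have := sum_prefix_sum (deg K); rewrite sumLK => EK EL.
apply: prefix_sum_inj => i; apply/eqP; rewrite eqn_leq prefLK andbT leqNgt.
apply/negP => lti.
suff : \sum_i prefix_sum (deg K) i < \sum_i prefix_sum (deg L) i by lia.
by rewrite (bigD1 i) // [X in _ < X](bigD1 i) //= -addSn leq_add // leq_sum.
Qed.

End WeakSeparation.

(* To pass from [k = 3] to [k = m + 3], the last [m] elements of
   'I_(N + m) are added to every triple of {0, ..., N-1}. *)
Section Blocks.
Variables N m : nat.
Implicit Types (e : seq nat) (es : seq (seq nat)) (S : {set 'I_(N + m)}).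

Definition block e : {set 'I_(N + m)} := [set i : 'I_(N + m) | (val i \in e) || (N <= i)].

Lemma sum_block e (f : nat -> nat) : uniq e -> all (fun j => j < N) e ->
  \sum_(i in block e) f i = \sum_(i <- e) f i + \sum_(N <= i < N + m) f i.
Proof.
move=> ue /allP eN.
rewrite (eq_bigl (fun i : 'I_(N + m) => (val i \in e) || (N <= i))); last first.
  by move=> i; rewrite inE.
rewrite -(big_mkord (fun i => (i \in e) || (N <= i)) f) (big_cat_nat _ (n := N)) ?leq_addr //=.
rewrite /index_iota subn0 addKn -big_filter -[X in _ + X = _]big_filter; congr (_ + _).
  apply/perm_big/uniq_perm; rewrite ?filter_uniq ?iota_uniq // => i.
  rewrite mem_filter mem_iota; apply/andP/idP => [[/orP[//|]]|ie].
    by rewrite leqNgt => /negbTE->.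
  by rewrite ie eN.
rewrite (eq_in_filter (a2 := predT)) ?filter_predT // => i.
by rewrite mem_iota => /andP[->]; rewrite orbT.
Qed.

Lemma card_block e : uniq e -> all (fun j => j < N) e -> #|block e| = size e + m.
Proof.
move=> ue eN; rewrite -sum1_card (sum_block (fun => 1) ue eN) sum_nat_const_nat.
by rewrite addKn muln1 sum1_size.
Qed.

Lemma count_block es (i : 'I_(N + m)) :
  count (fun S => i \in S) [seq block e | e <- es] =
  if i < N then count (fun e => val i \in e) es else size es.
Proof.
rewrite count_map -[size es]count_predT; case: (ltnP i N) => lt_iN.
  by apply: eq_count => e; rewrite /= inE leqNgt lt_iN orbF.
by apply: eq_count => e; rewrite /= inE lt_iN orbT.
Qed.

Lemma eq_count_block es es' : size es = size es' ->
  all (fun j => count (fun e => j \in e) es == count (fun e => j \in e) es') (iota 0 N) ->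
  forall i : 'I_(N + m), count (fun S => i \in S) [seq block e | e <- es] =
    count (fun S => i \in S) [seq block e | e <- es'].
Proof.
move=> eqsz /allP eqc i; rewrite !count_block; case: ifP => // lt_iN.
by apply/eqP/eqc; rewrite mem_iota.
Qed.

(** Inverts [block] on increasing lists below [N]; lists of naturals allow finite checks by
    computation. *)
Definition trace S : seq nat := [seq val i | i <- [seq i : 'I_(N + m) <- enum S | i < N]].

Lemma mem_trace S (i : 'I_(N + m)) : (val i \in trace S) = (i < N) && (i \in S).
Proof. by rewrite /trace (mem_map val_inj) mem_filter mem_enum. Qed.

Lemma trace_ltN S : all (fun j => j < N) (trace S).
Proof. by apply/allP => _ /mapP[i + ->]; rewrite mem_filter => /andP[]. Qed.

Lemma trace_sorted S : sorted ltn (trace S).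
Proof.
rewrite sorted_pairwise; last exact: ltn_trans.
by rewrite /trace pairwise_map; apply/pairwise_filter/increasing_enum.
Qed.

Lemma trace_block e : sorted ltn e -> all (fun j => j < N) e -> trace (block e) = e.
Proof.
move=> se /allP eN; apply: (irr_sorted_eq ltn_trans ltnn) => //; first exact: trace_sorted.
move=> j; apply/idP/idP => [jt|je].
  case/mapP: (jt) => i _ ej; move: jt; rewrite ej mem_trace => /andP[lt_iN].
  by rewrite inE leqNgt lt_iN orbF.
have ltj : j < N + m by apply: ltn_addr; apply: eN.
by rewrite -[j]/(val (Ordinal ltj)) mem_trace inE /= eN ?je.
Qed.

Definition triple e := [&& size e == 3, sorted ltn e & all (fun j => j < N) e].

Lemma trace_triple e : triple e -> trace (block e) = e.
Proof. by case/and3P=> _; apply: trace_block. Qed.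

Lemma block_inj : {in triple &, injective block}.
Proof. by move=> e f /trace_triple {2}<- /trace_triple {2}<- ->. Qed.

Lemma triple_uniq e : triple e -> uniq e.
Proof. by case/and3P=> _ /(sorted_uniq ltn_trans ltnn). Qed.

Lemma card_triple e : triple e -> #|block e| = m + 3.
Proof.
move=> te; have ue := triple_uniq te; case/and3P: te => /eqP se _ eN.
by rewrite card_block // se addnC.
Qed.

Lemma sum_triple e (f : nat -> nat) : triple e ->
  \sum_(i in block e) f i = \sum_(i <- e) f i + \sum_(N <= i < N + m) f i.
Proof.
by move=> te; apply: sum_block; [apply: triple_uniq | case/and3P: te].
Qed.

Lemma ksubset_triples es : all triple es ->
  all (ksubset (m + 3)) [seq block e | e <- es].
Proof.
by move=> /allP tes; apply/allP => _ /mapP[e /tes te ->]; rewrite /ksubset card_triple.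
Qed.

Lemma mem_map_block e es : triple e -> all triple es ->
  (block e \in [seq block f | f <- es]) = (e \in es).
Proof.
move=> te /allP tes; apply/mapP/idP => [[f fes /block_inj->]|ees] //; last by exists e.
exact: tes.
Qed.

Lemma sum_trace S (f : nat -> nat) : (forall i, N <= i -> f i = 0) ->
  \sum_(i in S) f i = \sum_(j <- trace S) f j.
Proof.
move=> f0; rewrite /trace big_map big_filter big_enum_cond /=.
rewrite [LHS](bigID (fun i : 'I_(N + m) => i < N)) /=.
by rewrite [X in _ + X]big1 ?addn0 // => i /andP[_]; rewrite -leqNgt => /f0.
Qed.

Lemma card_trace S : #|S| = size (trace S) + #|[set i : 'I_(N + m) in S | N <= i]|.
Proof.
rewrite /trace size_map -(cardsID [set i : 'I_(N + m) | i < N] S); congr (_ + _).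
  rewrite cardE; apply/perm_size/uniq_perm; first exact: enum_uniq.
    exact/filter_uniq/enum_uniq.
  by move=> i; rewrite mem_enum mem_filter mem_enum !inE andbC.
by apply: eq_card => i; rewrite !inE -leqNgt andbC.
Qed.

Lemma block_trace S : m <= #|[set i : 'I_(N + m) in S | N <= i]| -> S = block (trace S).
Proof.
move=> le_m; have cardV : #|[set i : 'I_(N + m) | N <= i]| = m.
  have -> : [set i : 'I_(N + m) | N <= i] = block [::].
    by apply/setP => i; rewrite !inE.
  by rewrite card_block.
have /eqP E : [set i : 'I_(N + m) in S | N <= i] == [set i : 'I_(N + m) | N <= i].
  by rewrite eqEcard cardV le_m andbT; apply/subsetP => i; rewrite !inE => /andP[].
apply/setP => i; rewrite inE mem_trace; have /setP/(_ i) := E; rewrite !inE.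
by case: (leqP N i) => [_|]; rewrite ?andbT ?andbF ?orbT //= ?orbF.
Qed.

End Blocks.

(** * Separating examples *)

(** The pair x, y has one element in each half of the ground set. Both halves are members, so the
    total weight exceeds 2 t. Neither the pair, being too small, nor its complement contains a
    member, so the total is at most 2 t. *)
Lemma threshold_not_setwise (R : realType) (k : nat) : 2 < k ->
  exists K : {set {set 'I_(k + k)}},
  [/\ kfamily k K, threshold R k K & ~ setwise_positive_threshold R K].
Proof.
move=> k2; have k0 : 0 < k by apply: leq_trans k2.
pose x : 'I_(k + k) := lshift k (Ordinal k0).
pose y : 'I_(k + k) := rshift k (Ordinal k0).
have nxy : x != y by rewrite -val_eqE /= addn0 eq_sym -lt0n.
pose K := [set S : {set 'I_(k + k)} | (#|S| == k) && ((x \in S) || (y \in S))].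
have memK S : (S \in K) = (#|S| == k) && ((x \in S) || (y \in S)) by rewrite inE.
exists K; split.
- by apply/kfamilyP => S; rewrite memK => /andP[/eqP].
- apply/thresholdP.
  (* A k-set meeting the pair weighs at least (k + 1) - k = 1, any other k-set weighs - k. *)
  exists (fun i => (k.+1 * ((i == x) + (i == y)))%:R - 1)%R => S Sk.
  have -> : (\sum_(i in S) ((k.+1 * ((i == x) + (i == y)))%:R - 1) =
            (k.+1 * ((x \in S) + (y \in S)))%:R - k%:R :> R)%R.
    rewrite sumrB sumr_const Sk -natr_sum -big_distrr big_split /=.
    have E z : \sum_(i in S) (i == z) = (z \in S).
      rewrite big_mkcond (bigD1 z) //= eqxx big1 ?addn0; first by case: (z \in S).
      by move=> i /negbTE->; case: ifP.
    by rewrite !E.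
  rewrite subr_gt0 ltr_nat memK Sk eqxx.
  by case: (x \in S); case: (y \in S); split=> //=; lia.
move=> [c [t [c0 t0 cP]]].
pose E := [set lshift k i | i : 'I_k].
have Ek : #|E| = k by rewrite card_imset ?card_ord //; apply: lshift_inj.
have xE : x \in E by apply: imset_f.
have yE : y \notin E.
  by apply/imsetP => -[i _ /eqP]; rewrite eq_sym eq_lrshift.
have lt_member S : S \in K -> (t < \sum_(i in S) c i)%R by move=> SK; apply/cP; exists S.
have ltE : (t < \sum_(i in E) c i)%R by apply: lt_member; rewrite memK Ek eqxx xE.
have ltE' : (t < \sum_(i in ~: E) c i)%R.
  apply: lt_member; rewrite memK cardsCs setCK Ek card_ord addKn eqxx /=.
  by rewrite !inE yE orbT.
have le_free (S : {set 'I_(k + k)}) :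
    (forall A, A \in K -> ~~ (A \subset S)) -> (\sum_(i in S) c i <= t)%R.
  move=> H; rewrite leNgt; apply/negP => /(proj2 (cP S))[A AK].
  by rewrite (negbTE (H A AK)).
have le1 : (\sum_(i in [set x; y]) c i <= t)%R.
  apply: le_free => A; rewrite memK => /andP[/eqP Ak _]; apply/negP => /subset_leq_card.
  by rewrite Ak cards2 nxy leqNgt k2.
have le2 : (\sum_(i in ~: [set x; y]) c i <= t)%R.
  apply: le_free => A; rewrite memK => /andP[_ xyA]; apply/negP => /subsetP sA.
  by case/orP: xyA => /sA; rewrite !inE eqxx ?orbT.
have split_sum (S : {set 'I_(k + k)}) : (\sum_i c i = \sum_(i in S) c i + \sum_(i in ~: S) c i)%R.
  rewrite (bigID (mem S)) /=; congr (_ + _)%R.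
  by apply: eq_bigl => i; rewrite !inE.
have := split_sum E; rewrite (split_sum [set x; y]); lra.
Qed.

Section UniquelyRealizableNotThreshold.
Variable m : nat.

(* The members of [ur_in] and [ur_out] satisfy only the linear dependency
   2 {0,1,2} + {3,4,5} + {6,7,12} + {8,9,10} + {11,12,13} = sum of [ur_out],
   and they are the only triples of weight 150.  Because of the coefficient 2,
   the dependency is not a trade between distinct sets.  They were found by a
   computer search. *)
Definition ur_in : seq (seq nat) :=
  [:: [:: 0; 1; 2]; [:: 3; 4; 5]; [:: 6; 7; 12]; [:: 8; 9; 10]; [:: 11; 12; 13]].
Definition ur_out : seq (seq nat) :=
  [:: [:: 1; 3; 12]; [:: 2; 7; 11]; [:: 0; 4; 8]; [:: 1; 6; 13]; [:: 0; 5; 9]; [:: 2; 10; 12]].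
Definition ur_weight (i : nat) : nat :=
  nth 0 [:: 52; 58; 40; 43; 48; 59; 47; 54; 50; 39; 61; 56; 49; 45] i.

Local Notation n := (14 + m).
Local Notation blk e := (block 14 m e).
Local Notation wt S := (weight (fun i : 'I_n => ur_weight i) S).

Definition ur_tie := ur_in ++ ur_out.

Definition ur_family : {set {set 'I_n}} :=
  [set S : {set 'I_n} | (#|S| == m + 3) &&
    ((wt S < 150) || (S \in [seq blk e | e <- ur_in]))].

(** The default value of [nth] makes the padding elements weightless. *)
Lemma ur_weight_eq0 i : 14 <= i -> ur_weight i = 0.
Proof. by move=> lei; rewrite /ur_weight nth_default. Qed.

Lemma triple_ur_tie e : e \in ur_tie -> triple 14 e.
Proof. by move: e; apply/allP. Qed.

Lemma ur_weight_trace (S : {set 'I_n}) : wt S = sumn [seq ur_weight j | j <- trace S].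
Proof. by rewrite /weight (sum_trace S ur_weight_eq0) sumnE big_map. Qed.

Lemma weight_ur_block e : e \in ur_tie -> wt (blk e) = 150.
Proof.
move=> eZ; rewrite ur_weight_trace trace_triple ?triple_ur_tie //; apply/eqP.
by apply: (allP (_ : all (fun e => sumn [seq ur_weight j | j <- e] == 150) ur_tie)).
Qed.

(** All weights below 14 are at least 39 and 4 * 39 > 150, so at most three elements lie below 14.
    By cardinality [S] then consists of exactly three of them and all the padding, and the triples
    are checked by computation. *)
Lemma ur_weight_tie (S : {set 'I_n}) :
  #|S| = m + 3 -> wt S = 150 -> S \in [seq blk e | e <- ur_tie].
Proof.
move=> Sk; rewrite ur_weight_trace => wS.
have le3 : size (trace S) <= 3.
  have : 39 * size (trace S) <= sumn [seq ur_weight j | j <- trace S].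
    have := trace_ltN S; elim: (trace S) => //= j s IHs /andP[ltj /IHs].
    have : 39 <= ur_weight j.
      apply: (allP (_ : all (fun j => 39 <= ur_weight j) (iota 0 14))) => //.
      by rewrite mem_iota.
    lia.
  rewrite wS; lia.
have cV : m <= #|[set i : 'I_n in S | 14 <= i]| by have := card_trace S; lia.
have ge3 : 3 <= size (trace S).
  have : #|[set i : 'I_n in S | 14 <= i]| <= #|blk [::]|.
    by apply/subset_leq_card/subsetP => i; rewrite !inE => /andP[].
  by rewrite card_block // add0n; have := card_trace S; lia.
rewrite (block_trace cV) map_f //.
move: (trace_sorted S) (trace_ltN S) wS le3 ge3.
case: (trace S) => [|a [|b [|c []]]] //= /and3P[ab bc _] /and4P[a14 b14 c14 _] wS _ _.
have : all (fun a => all (fun b => all (fun c =>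
    (a < b) && (b < c) && (ur_weight a + (ur_weight b + (ur_weight c + 0)) == 150) ==>
    ([:: a; b; c] \in ur_tie))
  (iota 0 14)) (iota 0 14)) (iota 0 14) by vm_compute.
move=> /allP/(_ a); rewrite mem_iota => /(_ a14) /allP/(_ b).
rewrite mem_iota => /(_ b14) /allP/(_ c); rewrite mem_iota => /(_ c14).
by rewrite ab bc wS.
Qed.

Lemma kfamily_ur : kfamily (m + 3) ur_family.
Proof. by apply/kfamilyP => S; rewrite inE => /andP[/eqP]. Qed.

Lemma mem_ur_block e : e \in ur_tie -> (blk e \in ur_family) = (e \in ur_in).
Proof.
move=> eZ; have te := triple_ur_tie eZ.
by rewrite inE card_triple // weight_ur_block // eqxx ltnn mem_map_block.
Qed.

Lemma deg_ur_tie (L : {set {set 'I_n}}) (i : 'I_n) : i < 14 ->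
  deg (L :&: [set S in [seq blk e | e <- ur_tie]]) i =
  sumn [seq (blk e \in L) * (val i \in e) | e <- ur_tie].
Proof.
move=> lti; rewrite degE sumnE big_map.
rewrite (eq_bigl (fun S => (S \in [seq blk e | e <- ur_tie]) && (S \in L))); last first.
  by move=> S; rewrite !inE andbC.
have uZ : uniq [seq blk e | e <- ur_tie].
  rewrite map_inj_in_uniq // => e f /triple_ur_tie te /triple_ur_tie; exact: block_inj.
rewrite big_mkcondr -(big_uniq _ uZ) big_map; apply: eq_bigr => e _; rewrite inE leqNgt lti orbF.
by case: (blk e \in L); rewrite ?mul1n ?mul0n.
Qed.

(** This uses that f takes only the values 0 and 1. Without {3,4,5}, the equations at 4 and 5 would
    select both {0,4,8} and {0,5,9}, against the equation at 0. The other values follow from the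
    equations at 3, 1, 2, 6, 8 and 11. *)
Lemma ur_tie_unique (f : seq nat -> bool) :
  (forall j, j < 14 -> sumn [seq f e * (j \in e) | e <- ur_tie] =
    sumn [seq (e \in ur_in) * (j \in e) | e <- ur_tie]) ->
  {in ur_tie, forall e, f e = (e \in ur_in)}.
Proof.
move=> H.
have [f012 f345 f048 f059] : [/\ f [:: 0; 1; 2], f [:: 3; 4; 5],
    f [:: 0; 4; 8] = false & f [:: 0; 5; 9] = false].
  move: (H 0 isT) (H 4 isT) (H 5 isT).
  by rewrite /= !muln1 !muln0 !addn0 !add0n; do 4 case: (f _).
have f1312 : f [:: 1; 3; 12] = false.
  by move: (H 3 isT); rewrite /= f345 !muln1 !muln0 !addn0 !add0n; case: (f [:: 1; 3; 12]).
have f1613 : f [:: 1; 6; 13] = false.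
  by move: (H 1 isT); rewrite /= f012 f1312 !muln1 !muln0 !addn0 !add0n; case: (f [:: 1; 6; 13]).
have [f2711 f21012] : f [:: 2; 7; 11] = false /\ f [:: 2; 10; 12] = false.
  by move: (H 2 isT); rewrite /= f012 !muln1 !muln0 !addn0 !add0n; do 2 case: (f _).
have f6712 : f [:: 6; 7; 12].
  by move: (H 6 isT); rewrite /= f1613 !muln1 !muln0 !addn0 !add0n; case: (f [:: 6; 7; 12]).
have f8910 : f [:: 8; 9; 10].
  by move: (H 8 isT); rewrite /= f048 !muln1 !muln0 !addn0 !add0n; case: (f [:: 8; 9; 10]).
have f111213 : f [:: 11; 12; 13].
  by move: (H 11 isT); rewrite /= f2711 !muln1 !muln0 !addn0 !add0n; case: (f [:: 11; 12; 13]).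
move=> e eZ; apply/eqP; move: e eZ; apply/allP => /=.
by rewrite f012 f345 f048 f059 f1312 f1613 f2711 f21012 f6712 f8910 f111213.
Qed.

Lemma unique_not_trade_robust : exists K : {set {set 'I_(14 + m)}},
  [/\ kfamily (m + 3) K, unique_deg (m + 3) K & ~ trade_robust (m + 3) K].
Proof.
exists ur_family; split; [exact: kfamily_ur | move=> L LP eqLK | move=> tK].
  have wtLK S : (S \in L) != (S \in ur_family) -> wt S = 150.
    apply: (weight_unique_deg kfamily_ur) LP eqLK S; rewrite ?addn3 // => S.
      by rewrite inE addn3 => -> ->; rewrite eqxx.
    rewrite inE => /andP[_ /orP[/ltnW//|/mapP[e eA ->]]].
    by rewrite weight_ur_block // mem_cat eA.
  (* [L] and the family can differ only inside [Z], so their degrees agree after restriction to [Z],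
     where the linear system has one solution. *)
  pose Z : {set {set 'I_n}} := [set S in [seq blk e | e <- ur_tie]].
  have eqD S : S \notin Z -> (S \in L) = (S \in ur_family).
    move=> nSZ; apply/eqP/contraT => nLK; case/negP: nSZ; rewrite inE.
    apply: ur_weight_tie (wtLK S nLK).
    have [SL|SL] := boolP (S \in L); first by move/kfamilyP: LP; apply.
    move: nLK; rewrite (negbTE SL) eq_sym eqbF_neg negbK.
    by move/kfamilyP: kfamily_ur; apply.
  have eqZ (j : nat) : j < 14 -> sumn [seq (blk e \in L) * (j \in e) | e <- ur_tie] =
      sumn [seq (blk e \in ur_family) * (j \in e) | e <- ur_tie].
    move=> ltj; have ltj' : j < n by apply: ltn_addr.
    have eqDZ : L :\: Z = ur_family :\: Z.
      by apply/setP => S; rewrite !in_setD; case: (boolP (S \in Z)) => //= /eqD.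
    have := eqLK (Ordinal ltj'); rewrite (deg_setID L Z) (deg_setID ur_family Z) eqDZ.
    by move/addIn; rewrite !deg_ur_tie.
  have memL : {in ur_tie, forall e, (blk e \in L) = (e \in ur_in)}.
    apply: ur_tie_unique => j ltj; rewrite eqZ //; congr sumn.
    by apply/eq_in_map => e eZ; rewrite mem_ur_block.
  apply/setP => S; have [|/eqD//] := boolP (S \in Z); rewrite inE => /mapP[e eZ ->].
  by rewrite memL // mem_ur_block.
(* The violated trade is the dependency itself, with {0,1,2} listed twice. *)
have sub_in : {subset [:: 0; 1; 2] :: ur_in <= ur_tie} by apply/allP.
have sub_out : {subset ur_out <= ur_tie} by apply/allP.
have t_in : all (triple 14) ([:: 0; 1; 2] :: ur_in) by [].
have t_out : all (triple 14) ur_out by [].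
have eqc := @eq_count_block 14 m ([:: 0; 1; 2] :: ur_in) ur_out erefl isT.
have [|S] := tK [seq blk e | e <- [:: 0; 1; 2] :: ur_in] [seq blk e | e <- ur_out]
  isT erefl (ksubset_triples m t_in) (ksubset_triples m t_out) eqc.
  move=> _ /mapP[e eA ->]; rewrite mem_ur_block ?sub_in //.
  by move: e eA; apply/allP.
case/mapP => e eB ->; rewrite mem_ur_block ?sub_out //.
by apply/negP; move: e eB; apply/allP.
Qed.

End UniquelyRealizableNotThreshold.

(* The rows and the columns of a 3 x 3 magic square with entries 0, ..., 8
   have the same weight and cover every entry once. *)
Definition magic_rows : seq (seq nat) := [:: [:: 1; 5; 6]; [:: 0; 4; 8]; [:: 2; 3; 7]].
Definition magic_columns : seq (seq nat) := [:: [:: 1; 3; 8]; [:: 2; 4; 6]; [:: 0; 5; 7]].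

Lemma max_deg_not_distinct_trade_robust m : exists K : {set {set 'I_(9 + m)}},
  [/\ kfamily (m + 3) K, max_deg (m + 3) K & ~ distinct_trade_robust (m + 3) K].
Proof.
(* The magic sum is (0 + ... + 8) / 3 = 12; the second term is the weight of the padding, common to
   all blocks. *)
pose T := 12 + \sum_(9 <= i < 9 + m) i.
pose wt (S : {set 'I_(9 + m)}) := weight (fun i : 'I_(9 + m) => i) S.
pose K := [set S : {set 'I_(9 + m)} |
  (#|S| == m + 3) && ((wt S < T) || (S \in [seq block 9 m e | e <- magic_rows]))].
have tR : all (triple 9) magic_rows by [].
have tC : all (triple 9) magic_columns by [].
have wtT e : e \in magic_rows ++ magic_columns -> wt (block 9 m e) = T.
  move=> eM; have te : triple 9 e by move: e eM; apply/allP.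
  rewrite /wt /weight (sum_triple m (fun i => i) te) /T; congr (_ + _).
  by rewrite -sumnE; apply/eqP; move: e eM {te}; apply/allP.
have KP : kfamily (m + 3) K by apply/kfamilyP => S; rewrite inE => /andP[/eqP].
exists K; split=> //.
  apply: (weight_max_deg (u := fun i => i) (T := T) KP); rewrite ?addn3 // => S.
    by rewrite inE addn3 /wt => -> ->; rewrite eqxx.
  rewrite inE => /andP[_ /orP[/ltnW//|/mapP[e eR ->]]].
  by rewrite -/(wt _) wtT // mem_cat eR.
move=> dK; have eqc := @eq_count_block 9 m magic_rows magic_columns erefl isT.
have uB es : all (triple 9) es -> uniq es -> uniq [seq block 9 m e | e <- es].
  move=> /allP tes ues; rewrite map_inj_in_uniq // => e f /tes te /tes; exact: block_inj.
have [|S] := dK [seq block 9 m e | e <- magic_rows] [seq block 9 m e | e <- magic_columns]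
  (uB _ tR isT) (uB _ tC isT) isT erefl (ksubset_triples m tR) (ksubset_triples m tC) eqc.
  move=> S SR; rewrite inE SR orbT andbT; case/mapP: SR => e /(allP tR) te ->.
  by rewrite card_triple.
case/mapP=> e eC ->; rewrite inE wtT ?mem_cat ?eC ?orbT // ltnn orFb.
rewrite mem_map_block ?(allP tC) // => /andP[_]; apply/negP; move: e eC; exact/allP.
Qed.

Section CompressedNotMaximal.
Variable m : nat.

(* Replacing the members of [cm_in] by those of [cm_out] moves one unit of
   degree from 9 to 8. *)
Definition cm_in : seq (seq nat) := [:: [:: 0; 6; 7]; [:: 1; 2; 9]; [:: 3; 4; 5]].
Definition cm_out : seq (seq nat) := [:: [:: 0; 3; 8]; [:: 1; 4; 6]; [:: 2; 5; 7]].

Definition below (x : nat) (S : {set 'I_(10 + m)}) := \sum_(i in S) (i < x).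

(** The Gale ideal generated by the blocks of [cm_in]: being smaller means having at least as many
    elements below every x. For x >= 10 this is automatic, since the blocks contain all the
    padding. *)
Definition cm_family := [set S : {set 'I_(10 + m)} | (#|S| == m + 3) &&
  has (fun e => all (fun x => count (fun j => j < x) e <= below x S) (iota 0 10)) cm_in].

(** Exchanging j for a smaller i lowers none of the counts [below x]. *)
Lemma compressed_cm : compressed cm_family.
Proof.
move=> i j lt_ij; apply/dominatesP => S; rewrite !inE => /andP[Sk /hasP[e ecm /allP eP]].
move=> jS iS; rewrite card_replace // Sk; apply/hasP; exists e => //.
apply/allP => x /eP le_x; apply: leq_trans le_x _.
rewrite /below (bigD1 j) //= /replace big_setU1 ?inE ?(negbTE iS) ?andbF //=.
rewrite [X in _ <= _ + X](eq_bigl (fun y => (y \in S) && (y != j))); last first.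
  by move=> y; rewrite !inE andbC.
rewrite leq_add2r; case: (ltnP j x) => // /(ltn_trans lt_ij) ->; exact: leqnn.
Qed.

Lemma below_block x e : x <= 10 -> triple 10 e ->
  below x (block 10 m e) = count (fun j => j < x) e.
Proof.
move=> le_x te; rewrite /below (sum_triple m (fun j => j < x) te).
rewrite [X in _ + X]big1_seq ?addn0 => [|i].
  by rewrite -sum1_count [RHS]big_mkcond; apply: eq_bigr => i _; case: ifP.
rewrite mem_index_iota => /and3P[_ le_i _].
by rewrite ltnNge (leq_trans le_x le_i).
Qed.

Lemma mem_cm e : triple 10 e -> (block 10 m e \in cm_family) =
  has (fun f => all (fun x => count (fun j => j < x) f <= count (fun j => j < x) e)
    (iota 0 10)) cm_in.
Proof.
move=> te; rewrite inE card_triple // eqxx; apply: eq_has => f; apply: eq_in_all => x.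
by rewrite mem_iota => /ltnW le_x; rewrite below_block.
Qed.

Lemma compressed_not_max_deg : exists K : {set {set 'I_(10 + m)}},
  [/\ kfamily (m + 3) K, compressed K & ~ max_deg (m + 3) K].
Proof.
have KP : kfamily (m + 3) cm_family by apply/kfamilyP => S; rewrite inE => /andP[/eqP].
exists cm_family; split=> //; first exact: compressed_cm.
have tA : all (triple 10) cm_in by [].
have tB : all (triple 10) cm_out by [].
pose A := [set S in [seq block 10 m e | e <- cm_in]].
pose B := [set S in [seq block 10 m e | e <- cm_out]].
have uB es : all (triple 10) es -> uniq es -> uniq [seq block 10 m e | e <- es].
  move=> /allP tes ues; rewrite map_inj_in_uniq // => e f /tes te /tes; exact: block_inj.
have sAK : A \subset cm_family.
  apply/subsetP => S; rewrite inE => /mapP[e eA ->]; rewrite mem_cm ?(allP tA) //.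
  by move: e eA; apply/allP.
(* No block of [cm_out] lies below a generator, so all three can be added as new members. *)
have dKB : [disjoint cm_family & B].
  rewrite disjoint_sym disjoint_subset; apply/subsetP => S; rewrite inE => /mapP[e eB ->].
  rewrite inE mem_cm ?(allP tB) //.
  by move: e eB; apply/allP.
have LP : kfamily (m + 3) (cm_family :\: A :|: B).
  apply: kfamily_exchange => // S; rewrite inE => /mapP[e eB ->].
  by rewrite card_triple // (allP tB).
pose p : 'I_(10 + m) := @Ordinal (10 + m) 8 isT.
pose q : 'I_(10 + m) := @Ordinal (10 + m) 9 isT.
have tr x : deg (cm_family :\: A :|: B) x + (x == q) = deg cm_family x + (x == p).
  have := deg_exchange x sAK dKB.
  rewrite (deg_uniq _ (uB _ tA isT)) (deg_uniq _ (uB _ tB isT)) !count_block.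
  rewrite -![x == _]val_eqE; case: ifP => [lt_x | /negbT]; last first.
    by rewrite -leqNgt => le_x; rewrite !gtn_eqF ?(leq_trans _ le_x) //= => /addIn->.
  have : count (fun e => val x \in e) cm_in + (val x == 8) =
      count (fun e => val x \in e) cm_out + (val x == 9).
    apply/eqP; have : val x \in iota 0 10 by rewrite mem_iota.
    by move: (val x); apply/allP.
  have arith (a b c d u v : nat) : a + u = b + v -> c + a = d + b -> c + v = d + u by lia.
  exact: arith.
have [maj neq] := transfer_majorizes (isT : p < q) tr.
by move=> maxK; apply: neq; apply: maxK.
Qed.

End CompressedNotMaximal.

(** * Assembling the chain of implications and closing it for k = 2 *)

Unset Implicit Arguments.

Theorem theorem3p1 (R : realType) (k : nat) (hk : 2 <= k) :
  (forall (n : nat) (K : {set {set 'I_n}}), 0 < n -> kfamily k K ->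
     (setwise_positive_threshold R K -> positive_threshold R k K) /\
     (positive_threshold R k K -> threshold R k K) /\
     (threshold R k K <-> vertex (degree_polytope R n k) (degseq R K)) /\
     (vertex (degree_polytope R n k) (degseq R K) <->
        (forall t : nat, 1 <= t -> CC R k t K)) /\
     ((forall t : nat, 1 <= t -> CC R k t K) -> uniquely_realizable R k K) /\
     (uniquely_realizable R k K <-> (forall t : nat, 1 <= t -> DCC R k t K)) /\
     ((forall t : nat, 1 <= t -> DCC R k t K) ->
        exists2 K', isomorphic K K' & degree_maximal R k K') /\
     ((exists2 K', isomorphic K K' & degree_maximal R k K') ->
        total (vicinal k K)) /\
     (total (vicinal k K) <-> RRST k K) /\
     (RRST k K <-> exists2 K', isomorphic K K' & shifted K')) /\
  (3 <= k ->
     (exists (n : nat) (K : {set {set 'I_n}}),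
        [/\ 0 < n, kfamily k K,
            threshold R k K & ~ setwise_positive_threshold R K]) /\
     (exists (n : nat) (K : {set {set 'I_n}}),
        [/\ 0 < n, kfamily k K, uniquely_realizable R k K &
            ~ (forall t : nat, 1 <= t -> CC R k t K)]) /\
     (exists (n : nat) (K : {set {set 'I_n}}),
        [/\ 0 < n, kfamily k K,
            exists2 K', isomorphic K K' & degree_maximal R k K' &
            ~ (forall t : nat, 1 <= t -> DCC R k t K)]) /\
     (exists (n : nat) (K : {set {set 'I_n}}),
        [/\ 0 < n, kfamily k K, total (vicinal k K) &
            ~ (exists2 K', isomorphic K K' & degree_maximal R k K')])) /\
  (k = 2 ->
     forall (n : nat) (K : {set {set 'I_n}}), 0 < n -> kfamily k K ->
     [<-> setwise_positive_threshold R K;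
          positive_threshold R k K;
          threshold R k K;
          vertex (degree_polytope R n k) (degseq R K);
          forall t : nat, 1 <= t -> CC R k t K;
          uniquely_realizable R k K;
          forall t : nat, 1 <= t -> DCC R k t K;
          exists2 K', isomorphic K K' & degree_maximal R k K';
          total (vicinal k K);
          RRST k K;
          exists2 K', isomorphic K K' & shifted K']).
Proof.
have k0 : 0 < k by apply: ltnW.
have main (n : nat) (K : {set {set 'I_n}}) (KP : kfamily k K) :
     (setwise_positive_threshold R K -> positive_threshold R k K) /\
     (positive_threshold R k K -> threshold R k K) /\
     (threshold R k K <-> vertex (degree_polytope R n k) (degseq R K)) /\
     (vertex (degree_polytope R n k) (degseq R K) <->
        (forall t : nat, 1 <= t -> CC R k t K)) /\
     ((forall t : nat, 1 <= t -> CC R k t K) -> uniquely_realizable R k K) /\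
     (uniquely_realizable R k K <-> (forall t : nat, 1 <= t -> DCC R k t K)) /\
     ((forall t : nat, 1 <= t -> DCC R k t K) ->
        exists2 K', isomorphic K K' & degree_maximal R k K') /\
     ((exists2 K', isomorphic K K' & degree_maximal R k K') ->
        total (vicinal k K)) /\
     (total (vicinal k K) <-> RRST k K) /\
     (RRST k K <-> exists2 K', isomorphic K K' & shifted K').
  have vCC := CC_trade_robust R k K; have vDCC := DCC_trade_robust R k K.
  have vUR := uniquely_realizable_deg R k K; have UR_DCC := unique_degP k0 KP.
  have thr_v := threshold_vertex k0 KP (R := R).
  have v_CC := vertex_trade_robust k0 KP (R := R).
  have CC_thr := trade_robust_threshold R k0 (K := K).
  have CC_DCC := trade_robust_distinct (k := k) (K := K).
  split; first exact: setwise_positive.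
  split; first exact: positive_threshold_threshold.
  split; first by split=> // /v_CC/CC_thr.
  split; first by split=> [/v_CC/vCC|/vCC/CC_thr/thr_v].
  split; first by move=> /vCC/CC_DCC/UR_DCC/vUR.
  split; first by split=> [/vUR/UR_DCC/vDCC|/vDCC/UR_DCC/vUR].
  split.
    move=> /vDCC/UR_DCC UR; apply/isomorphic_degree_maximal.
    exact: unique_deg_isomorphic_max.
  split.
    move=> /isomorphic_degree_maximal[_ [s <-] maxK]; apply/(total_vicinalE KP).
    apply: (total_relabel (s := s)); apply: compressed_total.
    by apply: max_deg_compressed maxK; apply: kfamily_relabel.
  split; first by apply: iff_trans (total_vicinalE KP) (iff_sym (RRSTE KP)).
  exact: iff_trans (RRSTE KP) (dominates_total_shifted K).
split; first by move=> n K _ KP; apply: main.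
split=> [k3|k2 n K _ KP].
  have [m ek] : exists m, k = m + 3 by exists (k - 3); rewrite subnK.
  split.
    have [K [KP tK nK]] := threshold_not_setwise R k3.
    by exists (k + k), K; rewrite addn_gt0 k0.
  rewrite ek; split.
    have [K [KP uK nK]] := unique_not_trade_robust m.
    exists (14 + m), K; split=> //; first exact/uniquely_realizable_deg.
    by move/CC_trade_robust.
  split.
    have [K [KP mK nK]] := max_deg_not_distinct_trade_robust m.
    exists (9 + m), K; split=> //; last by move/DCC_trade_robust.
    exists K; last exact/degree_maximal_deg.
    exists 1%g; rewrite -[RHS]imset_id; apply: eq_imset => S.
    by rewrite -[RHS]imset_id; apply: eq_imset => i; rewrite perm1.
  have [K [KP cK nK]] := compressed_not_max_deg m.
  exists (10 + m), K; split=> //.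
    exact/(total_vicinalE KP)/compressed_total.
  (* For a compressed family, a degree-maximal isomorphic copy would make the family itself
     degree-maximal. *)
  by case/isomorphic_degree_maximal => K' isoK maxK'; apply: nK; apply: isomorphic_max_deg maxK'.
have [p1 [p2 [p3 [p4 [p5 [p6 [p7 [p8 [p9 p10]]]]]]]]] := main n K KP.
tfae.
- exact: p1.
- exact: p2.
- exact: (proj1 p3).
- exact: (proj1 p4).
- exact: p5.
- exact: (proj1 p6).
- exact: p7.
- exact: p8.
- exact: (proj1 p9).
- exact: (proj1 p10).
(* For graphs the weakest condition returns to the set-wise form, the strongest, and closes the
   cycle. *)
- move=> /p10/(RRSTE KP); rewrite k2 in KP *; exact: graph_setwise_positive_threshold.
Qed.
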